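(* Let $k\ge 1$ and let $(\lambda_{i,h}^{(\ell)},u_{i,h}^{(\ell)})$, $i=1,\dots,k$, $\ell\ge 1$, be produced by the augmented subspace method for the first $k$ eigenpairs described in the context. For every integer $m\ge 1$ let $F_{k,h}^{(m)}:V_h\to{\rm span}\{u_{1,h}^{(m)},\dots,u_{k,h}^{(m)}\}$ be the spectral projection defined by $$a_h(F_{k,h}^{(m)}w,u_{i,h}^{(m)})=a_h(w,u_{i,h}^{(m)}),\quad i=1,\dots,k,\ w\in V_h,$$ and let $$\delta_{k,i,h}^{(m)}=\min_{k<j\le N_{H,h}}\left|\frac{1}{\lambda_{j,h}^{(m)}}-\frac{1}{\bar\lambda_{i,h}}\right|,$$ which are assumed to be positive. Then for every $\ell\ge 1$ and every $i=1,\dots,k$, $$\left\|\bar u_{i,h}-F_{k,h}^{(\ell+1)}\bar u_{i,h}\right\|_{a,h}\le\gamma\left\|\bar u_{i,h}-F_{k,h}^{(\ell)}\bar u_{i,h}\right\|_{a,h},$$ where $$\gamma=\bar\lambda_{i,h}\sqrt{1+\frac{\eta_a^2(W_H)}{\bar\lambda_{k+1,h}\big(\delta_{k,i,h}^{(\ell+1)}\big)^2}}\left(1+\frac{\bar\mu_{k+1,h}}{\delta_{k,i,h}^{(\ell)}}\right)\eta_a^2(W_H).$$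
   Context: Setting. $\Omega\subset\mathbb R^d$ ($d=2,3$) is a convex bounded polygonal or polyhedral domain, $A\in[L^\infty(\Omega)]^{d\times d}$ is symmetric and satisfies $c\,\xi^T\xi\le\xi^TA(x)\xi\le C\,\xi^T\xi$ for all $\xi\in\mathbb R^d$, $x\in\Omega$, with positive constants $c,C$. Weak Galerkin (WG) space. $\mathcal T_h$ is a shape-regular, quasi-uniform mesh of $\Omega$ by triangles/tetrahedra with edges/faces $\mathcal E_h$ and mesh size $h$. Fix an integer $r\ge 0$ and $t\in\{r,r+1\}$. $V_h$ is the space of $v=\{v_0,v_b\}$ with $v_0|_K\in\mathcal P_r(K)$ for each $K\in\mathcal T_h$, $v_b|_e\in\mathcal P_t(e)$ (single-valued) for each $e\in\mathcal E_h$, and $v_b|_e=0$ for $e\subset\partial\Omega$; no continuity between $v_0$ and $v_b$ is required. Set $G_r(K)=[\mathcal P_r(K)]^d+\widehat{\mathcal P}_r(K)\mathbf x$ if $t=r$ (Raviart-Thomas), with $\widehat{\mathcal P}_r(K)$ the homogeneous polynomials of degree $r$, and $G_r(K)=[\mathcal P_{r+1}(K)]^d$ if $t=r+1$ (BDM). The discrete weak gradient $\nabla_w v$ of $v\in V_h$ is defined on each $K$ by $\nabla_wv|_K\in G_r(K)$ and $(\nabla_wv,\mathbf q)_K=-(v_0,\nabla\cdot\mathbf q)_K+\langle v_b,\mathbf q\cdot\mathbf n\rangle_{\partial K}$ for all $\mathbf q\in G_r(K)$. Put $a_h(u,v)=\sum_{K}(A\nabla_wu,\nabla_wv)_K$,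 $b_h(u,v)=\sum_K(u_0,v_0)_K$, $\|v\|_{a,h}=\sqrt{a_h(v,v)}$, $\|v\|_{b,h}=\sqrt{b_h(v,v)}$. For $f\in L^2(\Omega)$, $b_h(f,v)=(f,v_0)_{L^2(\Omega)}$ and $\|f\|_{b,h}=\|f\|_{L^2(\Omega)}$. Discrete eigenvalue problem. The WG eigenpairs satisfy $a_h(\bar u_h,v_h)=\bar\lambda_hb_h(\bar u_h,v_h)$ for all $v_h\in V_h$. They are ordered $0<\bar\lambda_{1,h}\le\cdots\le\bar\lambda_{N_h,h}$, $N_h=\dim V_h$, with eigenfunctions $\bar u_{j,h}$ satisfying $a_h(\bar u_{i,h},\bar u_{j,h})=\delta_{ij}$, and $\bar\mu_{j,h}=1/\bar\lambda_{j,h}$. Since $b_h$ is only positive semidefinite, eigenpairs here and on subspaces of $V_h$ are understood in the form $b_h(u,v)=\mu\,a_h(u,v)$ with $\lambda=1/\mu$, where $\lambda=+\infty$ and $1/\lambda=0$ if $\mu=0$. Coarse space. $\mathcal T_H$ is a coarse mesh of size $H$, $\mathcal T_h$ is nested in $\mathcal T_H$, $W_H$ (dimension $N_H$) is the conforming linear finite element space on $\mathcal T_H$ (zero on $\partial\Omega$), and it is assumed that $W_H\subset V_h$, with $w$ identified with $\{w|_K,w|_e\}$. Let $T_h:L^2(\Omega)\to V_h$ be given by $a_h(T_hf,v)=b_h(f,v)$ for all $v\in V_h$, and $$\eta_a(W_H)=\sup_{f\in L^2(\Omega),\ \|f\|_{b,h}=1}\ \inf_{w_H\in W_H}\|T_hf-w_H\|_{a,h}.$$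 Augmented subspace method for the first $k$ eigenpairs. Start from given functions $\widehat u_{1,h}^{(1)},\dots,\widehat u_{k,h}^{(1)}\in V_h$. For each $\ell\ge 1$ let $V_{H,h}^{(\ell)}=W_H+{\rm span}\{\widehat u_{1,h}^{(\ell)},\dots,\widehat u_{k,h}^{(\ell)}\}$, with $N_{H,h}=\dim V_{H,h}^{(\ell)}=N_H+k$. Let $(\lambda_{j,h}^{(\ell)},u_{j,h}^{(\ell)})$, $1\le j\le N_{H,h}$, be all eigenpairs, in nondecreasing order of $\lambda_{j,h}^{(\ell)}$, of $a_h(u,v)=\lambda b_h(u,v)$ for all $v\in V_{H,h}^{(\ell)}$, $u\in V_{H,h}^{(\ell)}$, with $a_h(u_{i,h}^{(\ell)},u_{j,h}^{(\ell)})=\delta_{ij}$; the first $k$ eigenvalues are finite. For $i=1,\dots,k$ let $\widehat u_{i,h}^{(\ell+1)}\in V_h$ solve $a_h(\widehat u_{i,h}^{(\ell+1)},v_h)=\lambda_{i,h}^{(\ell)}b_h(u_{i,h}^{(\ell)},v_h)$ for all $v_h\in V_h$. Then repeat with $\ell+1$. *)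

(* Defs.v *)
From HB Require Import structures.
From mathcomp Require Import all_boot all_order all_algebra finmap.
(* The notations of mpoly clash with those of MathComp-Analysis. *)
From mathcomp Require mpoly.
Import -(notations) mpoly.
From mathcomp Require Import all_classical all_reals all_analysis.
Set Implicit Arguments. Unset Strict Implicit. Unset Printing Implicit Defensive.
Import Order.TTheory GRing.Theory Num.Theory.
Import numFieldNormedType.Exports.
Local Open Scope classical_set_scope.
Local Open Scope ring_scope.

(* Borel sigma-algebra on row vectors, generated by the coordinates as for
   n.-tuple T in MathComp-Analysis. *)
Definition rV_display : measure_display -> measure_display.
Proof. exact. Qed.

Section measurable_rV.
Context {dsp : measure_display} {T : measurableType dsp} (n : nat).
Definition rV_coord (i : 'I_n) (x : 'rV[T]_n) : T := x 0 i.
Let rV_set0 : g_sigma_preimage rV_coord set0.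
Proof. exact: sigma_algebra0. Qed.
Let rV_setC A : g_sigma_preimage rV_coord A -> g_sigma_preimage rV_coord (~` A).
Proof. exact: sigma_algebraC. Qed.
Let rV_bigcup (F : _^nat) : (forall i, g_sigma_preimage rV_coord (F i)) ->
  g_sigma_preimage rV_coord (\bigcup_i (F i)).
Proof. exact: sigma_algebra_bigcup. Qed.
HB.instance Definition _ := @isMeasurable.Build (rV_display dsp)
  'rV[T]_n (g_sigma_preimage rV_coord) rV_set0 rV_setC rV_bigcup.
End measurable_rV.

Lemma measurable_rV_coord dsp (T : measurableType dsp) n (i : 'I_n) :
  measurable_fun [set: 'rV[T]_n] (rV_coord i).
Proof.
move=> _ Y mY; rewrite setTI; apply: sub_sigma_algebra => /=.
rewrite -bigcup_seq/=; exists i => /=; first by rewrite mem_index_enum.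
by exists Y => //; rewrite setTI.
Qed.

Lemma measurable_fun_rVP d1 d2 (S : measurableType d1) (T : measurableType d2) n
    (f : S -> 'rV[T]_n) :
  (forall i, measurable_fun [set: S] (rV_coord i \o f)) ->
  measurable_fun [set: S] f.
Proof.
move=> mf _ A mA; rewrite setTI; move: A mA.
pose G : set (set 'rV[T]_n) := [set A | measurable (f @^-1` A)].
suff: @measurable _ 'rV[T]_n `<=` G by [].
apply: smallest_sub; first split=> /=.
- by rewrite /G/= preimage_set0.
- by move=> A; rewrite /G/= setTD -preimage_setC; exact: measurableC.
- by move=> F mF; rewrite /G/= preimage_bigcup; apply: bigcupT_measurable.
rewrite -bigcup_seq => A [i _ [B mB <-]]; rewrite /G/= setTI -comp_preimage.
by rewrite -[X in measurable X]setTI; exact: mf.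
Qed.

Section lebesgue_rV.
Variable R : realType.

Definition rV_cons n (p : measurableTypeR R * 'rV[R]_n) : 'rV[R]_n.+1 :=
  row_mx (const_mx p.1 : 'rV_1) p.2.

Definition rV_uncons n (x : 'rV[R]_n.+1) : measurableTypeR R * 'rV[R]_n :=
  (x 0 ord0, \row_i x 0 (lift ord0 i)).

Lemma rV_cons0 n p : @rV_cons n p 0 ord0 = p.1.
Proof. by rewrite mxE; case: splitP => // j; rewrite mxE. Qed.

Lemma rV_consS n p i : @rV_cons n p 0 (lift ord0 i) = p.2 0 i.
Proof.
rewrite mxE; case: splitP => /= [j|k]; first by rewrite ord1.
by rewrite /bump/= !add1n => -[/val_inj ->].
Qed.

Lemma rV_consK n : cancel (@rV_cons n) (@rV_uncons n).
Proof.
move=> p; rewrite /rV_uncons rV_cons0 [RHS]surjective_pairing; congr pair.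
by apply/rowP => i; rewrite mxE rV_consS.
Qed.

Lemma rV_unconsK n : cancel (@rV_uncons n) (@rV_cons n).
Proof.
move=> x; apply/rowP => i; case: (unliftP ord0 i) => [j ->|->].
  by rewrite rV_consS mxE.
by rewrite rV_cons0.
Qed.

Lemma measurable_rV_cons n : measurable_fun setT (@rV_cons n).
Proof.
apply: measurable_fun_rVP => i; case: (unliftP ord0 i) => [j ->|->].
- rewrite (_ : _ \o _ = rV_coord j \o snd).
    by apply: measurableT_comp => //; exact: measurable_rV_coord.
  by apply/funext => p; rewrite /= /rV_coord rV_consS.
- by rewrite (_ : _ \o _ = fst) //; apply/funext => p; rewrite /= /rV_coord rV_cons0.
Qed.

Lemma measurable_rV_uncons n : measurable_fun setT (@rV_uncons n).
Proof.
apply: measurable_fun_pair; first exact: (measurable_rV_coord ord0).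
apply: measurable_fun_rVP => i.
rewrite (_ : _ \o _ = rV_coord (lift ord0 i)); first exact: measurable_rV_coord.
by apply/funext => x; rewrite /rV_coord /= mxE.
Qed.

Section step.
Variables (n : nat) (mu : {sigma_finite_measure set 'rV[R]_n -> \bar R}).
Local Notation prod := (lebesgue_measure \x mu)%E.

Definition lebesgue_rVS : set 'rV[R]_n.+1 -> \bar R :=
  pushforward prod (@rV_cons n).

Let meas_pre A : measurable A -> measurable (@rV_cons n @^-1` A).
Proof. by move=> mA; rewrite -[X in measurable X]setTI; exact: measurable_rV_cons. Qed.

Let lebesgue_rVS0 : lebesgue_rVS set0 = 0%E.
Proof. by rewrite /lebesgue_rVS /pushforward preimage_set0 measure0. Qed.

Let lebesgue_rVS_ge0 A : (0 <= lebesgue_rVS A)%E.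
Proof. exact: (@measure_ge0 _ _ _ prod). Qed.

Let lebesgue_rVS_sigma_additive : semi_sigma_additive lebesgue_rVS.
Proof.
move=> F mF tF mUF; rewrite /lebesgue_rVS /pushforward preimage_bigcup.
apply: (@measure_semi_sigma_additive _ _ _ prod).
- by move=> k; exact: meas_pre.
- apply/trivIsetP => /= i j _ _ ij; rewrite -preimage_setI.
  by move/trivIsetP : tF => /(_ _ _ _ _ ij) ->//; rewrite preimage_set0.
- by rewrite -preimage_bigcup; exact: meas_pre.
Qed.

HB.instance Definition _ := isMeasure.Build _ _ _ lebesgue_rVS
  lebesgue_rVS0 lebesgue_rVS_ge0 lebesgue_rVS_sigma_additive.

Let lebesgue_rVS_sigma_finite : sigma_finite setT lebesgue_rVS.
Proof.
have /sigma_finiteP[F [TF ndF Foo]] := sigma_finiteT (@lebesgue_measure R).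
have /sigma_finiteP[G [TG ndG Goo]] := sigma_finiteT mu.
exists (fun k => @rV_uncons n @^-1` (F k `*` G k)).
  apply/esym; rewrite -preimage_bigcup -subTset => x _ /=.
  have [i _ Fi] : (\bigcup_i F i) (rV_uncons x).1 by rewrite -TF.
  have [j _ Gj] : (\bigcup_i G i) (rV_uncons x).2 by rewrite -TG.
  exists (maxn i j) => //; split.
  - by move: Fi; exact/subsetPset/ndF/leq_maxl.
  - by move: Gj; exact/subsetPset/ndG/leq_maxr.
move=> k; have [mF oF] := Foo k; have [mG oG] := Goo k.
have mFG : measurable (F k `*` G k) by exact: measurableX.
split; first by rewrite -[X in measurable X]setTI; exact: measurable_rV_uncons.
rewrite /lebesgue_rVS /pushforward -comp_preimage.
rewrite (_ : _ \o _ = id) ?preimage_id; last by apply/funext => p /=; rewrite rV_consK.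
by rewrite product_measure1E// lte_mul_pinfty// ge0_fin_numE.
Qed.

HB.instance Definition _ := Measure_isSigmaFinite.Build _ _ _ lebesgue_rVS
  lebesgue_rVS_sigma_finite.
End step.

(* n-dimensional Lebesgue measure, on the Borel sets of R^n. *)
Fixpoint lebesgue_rV n : {sigma_finite_measure set 'rV[R]_n -> \bar R} :=
  match n return {sigma_finite_measure set 'rV[R]_n -> \bar R} with
  | 0 => \d_(0 : 'rV[R]_0)
  | n'.+1 => lebesgue_rVS (lebesgue_rV n')
  end.
End lebesgue_rV.

Section linear_algebra.
Variables (R : realType) (E : lmodType R).

Definition has_dim (V : set E) (n : nat) : Prop :=
  exists b : 'I_n -> E,
    (forall c : 'I_n -> R, \sum_i c i *: b i = 0 -> forall i, c i = 0) /\
    V = [set \sum_i c i *: b i | c in [set: 'I_n -> R]].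

Definition lspan (k : nat) (u : nat -> E) : set E :=
  [set \sum_(1 <= i < k.+1) c i *: u i | c in [set: nat -> R]].

End linear_algebra.

Section geometry.
Variables (R : realType) (d : nat).
Notation pt := 'rV[R]_d.

Definition dot (x y : pt) : R := \sum_i x 0 i * y 0 i.

(* The norm `|x| of MathComp-Analysis on matrices is the maximum norm. *)
Definition enorm (x : pt) : R := Num.sqrt (dot x x).

(* A simplex (cell, edge or face) is given by the finite set of its vertices:
   [hull S] is the closed simplex and [rhull S] its relative interior. *)
Definition hull (S : {fset pt}) : set pt :=
  [set x | exists c : pt -> R, [/\ forall p, p \in S -> 0 <= c p,
    \sum_(p <- S) c p = 1 & x = \sum_(p <- S) c p *: p]].

Definition rhull (S : {fset pt}) : set pt :=
  [set x | exists c : pt -> R, [/\ forall p, p \in S -> 0 < c p,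
    \sum_(p <- S) c p = 1 & x = \sum_(p <- S) c p *: p]].

Definition aff_indep (S : {fset pt}) : Prop :=
  forall c : pt -> R, \sum_(p <- S) c p = 0 -> \sum_(p <- S) c p *: p = 0 ->
  forall p, p \in S -> c p = 0.

(* Bounded nonempty finite intersections of open half-spaces; these are the
   convex bounded polygonal (d = 2) or polyhedral (d = 3) domains. *)
Definition convex_polyhedral_domain (Omega : set pt) : Prop :=
  [/\ Omega !=set0, bounded_set Omega &
    exists (m : nat) (nu : 'I_m -> pt) (beta : 'I_m -> R),
      (forall i, nu i != 0) /\
      Omega = [set x | forall i, dot (nu i) x < beta i]].

Definition is_mesh (Omega : set pt) (T : {fset {fset pt}}) : Prop :=
  [/\ forall K, K \in T -> #|` K| = d.+1 /\ aff_indep K,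
      forall K L, K \in T -> L \in T -> hull K `&` hull L = hull (K `&` L)%fset &
      \bigcup_(K in [set` T]) hull K = closure Omega].

(* The edges (d = 2) or faces (d = 3) of the mesh. *)
Definition mesh_faces (T : {fset {fset pt}}) : set {fset pt} :=
  [set e | exists K p, [/\ K \in T, p \in K & e = (K `\ p)%fset]].

Definition nested (T TH : {fset {fset pt}}) : Prop :=
  forall K, K \in T -> exists2 L, L \in TH & hull K `<=` hull L.

Definition diam (K : {fset pt}) : R :=
  sup [set enorm (x - y) | x in hull K & y in hull K].

Definition inradius (K : {fset pt}) : R :=
  sup [set rho | 0 <= rho /\
    exists c : pt, [set x | enorm (x - c) <= rho] `<=` hull K].

Definition mesh_size (T : {fset {fset pt}}) : R :=
  sup [set diam K | K in [set` T]].

Definition shape_regular (sigma : R) (T : {fset {fset pt}}) : Prop :=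
  forall K, K \in T -> diam K <= sigma * inradius K.

Definition quasi_uniform (tau : R) (T : {fset {fset pt}}) : Prop :=
  forall K, K \in T -> mesh_size T <= tau * diam K.

(* The outward unit normal of the cell K on its face opposite to the vertex p. *)
Definition outward_normal (K : {fset pt}) (p : pt) : pt :=
  xget 0 [set n : pt | [/\ enorm n = 1,
    forall x y, x \in (K `\ p)%fset -> y \in (K `\ p)%fset -> dot n (x - y) = 0 &
    forall x, x \in (K `\ p)%fset -> dot n (p - x) < 0]].

Definition ref_simplex (n : nat) : set 'rV[R]_n :=
  [set s | (forall i, 0 < s 0 i) /\ \sum_i s 0 i < 1].

(* Integral over a (d-1)-dimensional simplex e for the surface measure, through
   an affine parametrization; its value does not depend on the enumeration of
   the vertices of e. *)
Definition face_integral (e : {fset pt}) (g : pt -> R) : R :=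
  let p0 := nth 0 e 0%N in
  let J (i : 'I_d.-1) := nth 0 e i.+1 - p0 in
  Num.sqrt (\det (\matrix_(i, j) dot (J i) (J j))) *
  \int[lebesgue_rV R d.-1]_(s in @ref_simplex d.-1)
    g (p0 + \sum_i s 0 i *: J i).

End geometry.

Section polynomials.
Variables (R : realType) (d : nat).
Notation pt := 'rV[R]_d.

Definition pfun (p : mpoly d R) (x : pt) : R := meval (x 0) p.

Definition Poly_le (n : nat) : set (mpoly d R) := [set p | (msize p <= n.+1)%N].

(* Polynomial vector fields, given by their components. *)
Definition pfield := 'I_d -> mpoly d R.

Definition field_at (q : pfield) (x : pt) : pt := \row_i pfun (q i) x.

Definition div_at (q : pfield) (x : pt) : R := pfun (\sum_i mderiv i (q i)) x.

(* The local space G_r(K): Raviart-Thomas if t = r, BDM if t = r + 1. *)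
Definition Gspace (r t : nat) : set pfield :=
  if t == r then
    [set q | exists (p : pfield) (ph : mpoly d R),
      [/\ forall i, Poly_le r (p i), ph \is ishomog1 r mdeg &
          forall i, q i = p i + ph * mpolyX R (mnm1 i)]]
  else [set q | forall i, Poly_le r.+1 (q i)].

End polynomials.

Section weak_galerkin.
Variables (R : realType) (d : nat).
Notation pt := 'rV[R]_d.
Notation cell := {fset 'rV[R]_d}.
Notation mesh := {fset {fset 'rV[R]_d}}.
Notation mu := (lebesgue_rV R d).

(* Weak functions v = {v_0, v_b}.  The cells being represented by their interiors
   and the faces by their relative interiors, which are pairwise disjoint, v_0 and
   v_b are functions on R^d, set to 0 outside the cells and the faces. *)
Definition wfun : Type := ((pt -> R) * (pt -> R))%type.
HB.instance Definition _ := GRing.Lmodule.copy wfun ((pt -> R) * (pt -> R))%type.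

Definition cells_dom (T : mesh) : set pt := \bigcup_(K in [set` T]) rhull K.
Definition faces_dom (T : mesh) : set pt := \bigcup_(e in mesh_faces T) rhull e.

Definition WGspace (Omega : set pt) (T : mesh) (r t : nat) : set wfun :=
  [set v |
    [/\ forall K, K \in T ->
          exists2 p, Poly_le r p & forall x, rhull K x -> v.1 x = pfun p x,
        forall x, ~ cells_dom T x -> v.1 x = 0,
        forall e, mesh_faces T e ->
          exists2 p, Poly_le t p & forall x, rhull e x -> v.2 x = pfun p x,
        forall x, ~ faces_dom T x -> v.2 x = 0 &
        forall e, mesh_faces T e -> hull e `<=` closure Omega `\` Omega ->
          forall x, rhull e x -> v.2 x = 0]].

(* [grad v K] is the restriction to K of the discrete weak gradient of v; it is
   uniquely determined by this property. *)
Definition is_weak_gradient (T : mesh) (r t : nat) (V : set wfun)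
    (grad : wfun -> cell -> pfield R d) : Prop :=
  forall v K, V v -> K \in T -> Gspace r t (grad v K) /\
  forall q, Gspace r t q ->
    \int[mu]_(x in rhull K) dot (field_at (grad v K) x) (field_at q x) =
    - \int[mu]_(x in rhull K) (v.1 x * div_at q x) +
    \sum_(p <- K) face_integral (K `\ p)%fset
      (fun x => v.2 x * dot (field_at q x) (outward_normal K p)).

Definition diffusion_tensor (Omega : set pt) (A : pt -> 'M[R]_d) (c C : R) : Prop :=
  [/\ forall i j, measurable_fun Omega (fun x => A x i j),
      forall i j, exists M : R, {ae mu, forall x, Omega x -> `|A x i j| <= M},
      forall x, Omega x -> (A x)^T = A x &
      forall x xi, Omega x -> c * dot xi xi <= dot (xi *m A x) xi <= C * dot xi xi].

Definition a_h (T : mesh) (A : pt -> 'M[R]_d) (grad : wfun -> cell -> pfield R d)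
    (u v : wfun) : R :=
  \sum_(K <- T) \int[mu]_(x in rhull K)
    dot (field_at (grad u K) x *m (A x)^T) (field_at (grad v K) x).

Definition b_h (T : mesh) (u v : wfun) : R :=
  \sum_(K <- T) \int[mu]_(x in rhull K) (u.1 x * v.1 x).

Definition L2fun (Omega : set pt) (f : pt -> R) : Prop :=
  measurable_fun Omega f /\ mu.-integrable Omega (fun x => (f x ^+ 2)%:E).

Definition L2norm (Omega : set pt) (f : pt -> R) : R :=
  Num.sqrt (\int[mu]_(x in Omega) (f x ^+ 2)).

Definition b_hf (Omega : set pt) (f : pt -> R) (v : wfun) : R :=
  \int[mu]_(x in Omega) (f x * v.1 x).

(* Conforming linear elements vanishing on the boundary of Omega, extended by 0
   outside Omega. *)
Definition P1space (Omega : set pt) (T : mesh) : set (pt -> R) :=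
  [set w | [/\ continuous w,
    forall K, K \in T ->
      exists2 p, Poly_le 1 p & forall x, hull K x -> w x = pfun p x &
    forall x, ~ Omega x -> w x = 0]].

(* The identification of w with the weak function {w|_K, w|_e}. *)
Definition to_wfun (T : mesh) (w : pt -> R) : wfun :=
  (fun x => if x \in cells_dom T then w x else 0,
   fun x => if x \in faces_dom T then w x else 0).

End weak_galerkin.

Section eigenvalue_problem.
Variables (R : realType) (E : lmodType R) (a b : E -> E -> R).

Definition form_norm (v : E) : R := Num.sqrt (a v v).

(* 1 / lam as a real number, with 1 / +oo = 0. *)
Definition rcp (lam : \bar R) : R := fine (lam^-1)%E.

(* (lam j, u j), 1 <= j <= N, are the N = dim V eigenpairs of a(u, v) = lam b(u, v)
   on V, in the form b(u, v) = (1 / lam) a(u, v) with 0 < lam <= +oo. *)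
Definition all_eigenpairs (V : set E) (N : nat) (lam : nat -> \bar R)
    (u : nat -> E) : Prop :=
  [/\ has_dim V N,
      forall j, (1 <= j <= N)%N -> [/\ (0 < lam j)%E, V (u j) &
        forall v, V v -> b (u j) v = rcp (lam j) * a (u j) v],
      forall i j, (1 <= i <= j)%N -> (j <= N)%N -> (lam i <= lam j)%E &
      forall i j, (1 <= i <= N)%N -> (1 <= j <= N)%N -> a (u i) (u j) = (i == j)%:R].

Definition augmented_space (W : set E) (k : nat) (uhat : nat -> E) : set E :=
  [set w + s | w in W & s in lspan k uhat].

(* Iterates uhat l, lam l, u l (l >= 1) of the augmented subspace method. *)
Definition augmented_subspace_method (V W : set E) (NW k : nat)
    (uhat : nat -> nat -> E) (lam : nat -> nat -> \bar R) (u : nat -> nat -> E) : Prop :=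
  (forall i, (1 <= i <= k)%N -> V (uhat 1%N i)) /\
  forall l, (1 <= l)%N ->
    [/\ all_eigenpairs (augmented_space W k (uhat l)) (NW + k) (lam l) (u l),
        forall i, (1 <= i <= k)%N -> (lam l i < +oo)%E &
        forall i, (1 <= i <= k)%N -> V (uhat l.+1 i) /\
          forall v, V v -> a (uhat l.+1 i) v = fine (lam l i) * b (u l i) v].

Definition is_spectral_projection (V : set E) (k : nat) (u : nat -> E)
    (F : E -> E) : Prop :=
  forall w, V w -> lspan k u (F w) /\
    forall i, (1 <= i <= k)%N -> a (F w) (u i) = a w (u i).

(* min_(k < j <= N) |1 / lam j - 1 / lambar|.  The infimum of a finite
   nonempty set is attained; inf is 0 on the empty set, so 0 < spectral_gap entails
   k < N. *)
Definition spectral_gap (k N : nat) (lam : nat -> \bar R) (lambar : \bar R) : R :=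
  inf [set `|rcp (lam j) - rcp lambar| | j in [set j | (k < j <= N)%N]].

End eigenvalue_problem.

Section eta.
Variables (R : realType) (d : nat).
Notation pt := 'rV[R]_d.

Definition is_solution_operator (Omega : set pt)
    (a : wfun R d -> wfun R d -> R) (V : set (wfun R d))
    (S : (pt -> R) -> wfun R d) : Prop :=
  forall f, L2fun Omega f -> V (S f) /\ forall v, V v -> a (S f) v = b_hf Omega f v.

Definition eta_a (Omega : set pt) (a : wfun R d -> wfun R d -> R)
    (S : (pt -> R) -> wfun R d) (W : set (wfun R d)) : R :=
  sup [set inf [set form_norm a (S f - w) | w in W] |
    f in [set f | L2fun Omega f /\ L2norm Omega f = 1]].

End eta.

(* Main.v *)
(* Let T be the operator with a(T g, v) = b(g, v) on V_h, v = ub i an eigenfunction,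
   P the a-orthogonal projection on V_{H,h}^(l), e = v - P v, and
   mu_j = 1 / lam l j, mub_j = 1 / lamb j.
   - N a-orthonormal eigenfunctions of an N-dimensional space form a basis that
     diagonalizes both forms; this alone gives the symmetry and positivity of a and b.
   - Aubin-Nitsche: if x is a-orthogonal to W_H, then b(x, x) = a(T x - w, x) for all
     w in W_H, hence |x|_b <= eta |x|_a.
   - The coefficients of P v - F v on u l j, j > k, satisfy
     (mub_i - mu_j) a(v, u_j) = b(e, u_j).  By Bessel's inequality for the b-orthogonal
     u_j, with mu_j <= mu_{k+1} <= mub_{k+1} (min-max principle),
       delta^2 |P v - F v|_a^2 <= mub_{k+1} |e|_b^2,
     which bounds |v - F v|_a by |e|_a and |v - F v|_b by |v - F v|_a.
   - V_{H,h}^(l+1) contains W_H and T (F l v), and v = lamb_i T v, so that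
     |v - P^(l+1) v|_a <= lamb_i inf_w |T (v - F l v) - w|_a <= lamb_i eta |v - F l v|_b.
   On the analytic side one needs that a_h and b_h are bilinear on V_h, that b_h is the
   L^2(Omega) product of the interior parts, and that the supremum defining eta is
   finite. *)
Require Import Defs.
From mathcomp Require Import all_boot all_order all_algebra finmap.
From mathcomp Require mpoly.
Import -(notations) mpoly.
From mathcomp Require Import all_classical all_reals all_analysis.
From mathcomp Require Import measurable_realfun ring lra.
Set Implicit Arguments. Unset Strict Implicit. Unset Printing Implicit Defensive.
Import Order.TTheory GRing.Theory Num.Theory.
Import numFieldNormedType.Exports.
Local Open Scope classical_set_scope.
Local Open Scope ring_scope.

(** * Spectral approximation in subspaces *)

Section forms.
Variables (R : realType) (E : lmodType R).
Implicit Types (V : set E) (a : E -> E -> R) (s : seq nat).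

Definition subspace V :=
  V 0 /\ forall (c : R) x y, V x -> V y -> V (c *: x + y).

(** Linearity is required for arguments in [V] only: the weak gradient [grad v K] is specified for
    [v] in the weak Galerkin space, and [a_h] is not known to be bilinear elsewhere. *)
Definition bilinear_on V a :=
  forall (c : R) x y z, V x -> V y -> V z ->
    a (c *: x + y) z = c * a x z + a y z /\
    a z (c *: x + y) = c * a z x + a z y.

Definition symmetric_on V a := forall x y, V x -> V y -> a x y = a y x.

Lemma has_dim_subspace V n : has_dim V n -> subspace V.
Proof.
case=> e [_ ->]; split; first by exists (fun=> 0) => //; apply: big1 => i _; rewrite scale0r.
move=> c _ _ [x _ <-] [y _ <-]; exists (fun i => c * x i + y i) => //.
rewrite scaler_sumr -big_split /=; apply: eq_bigr => i _.
by rewrite scalerDl scalerA.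
Qed.

Section on_subspace.
Variables (V : set E) (sV : subspace V).

Lemma subspaceD x y : V x -> V y -> V (x + y).
Proof. by move=> Vx Vy; rewrite -[x]scale1r; apply: sV.2. Qed.

Lemma subspaceZ c x : V x -> V (c *: x).
Proof. by move=> Vx; rewrite -[_ *: _]addr0; apply: sV.2 => //; exact: sV.1. Qed.

Lemma subspaceB x y : V x -> V y -> V (x - y).
Proof. by move=> Vx Vy; rewrite addrC -scaleN1r; apply: sV.2. Qed.

Lemma subspace_sum s (c : nat -> R) (x : nat -> E) :
  {in s, forall i, V (x i)} -> V (\sum_(i <- s) c i *: x i).
Proof.
elim: s => [|i s IH] Vs; first by rewrite big_nil; exact: sV.1.
rewrite big_cons; apply: sV.2; first by apply: Vs; rewrite mem_head.
by apply: IH => j sj; apply: Vs; rewrite inE sj orbT.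
Qed.

Variables (a : E -> E -> R) (ba : bilinear_on V a).

Lemma formDl x y z : V x -> V y -> V z -> a (x + y) z = a x z + a y z.
Proof. by move=> Vx Vy Vz; have [+ _] := ba 1 Vx Vy Vz; rewrite scale1r mul1r. Qed.

Lemma formDr x y z : V x -> V y -> V z -> a z (x + y) = a z x + a z y.
Proof. by move=> Vx Vy Vz; have [_] := ba 1 Vx Vy Vz; rewrite scale1r mul1r. Qed.

Lemma form0l z : V z -> a 0 z = 0.
Proof.
move=> Vz; have V0 := sV.1; have := formDl V0 V0 Vz.
by rewrite addr0 => /eqP; rewrite -subr_eq subrr => /eqP.
Qed.

Lemma form0r z : V z -> a z 0 = 0.
Proof.
move=> Vz; have V0 := sV.1; have := formDr V0 V0 Vz.
by rewrite addr0 => /eqP; rewrite -subr_eq subrr => /eqP.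
Qed.

Lemma formZl c x z : V x -> V z -> a (c *: x) z = c * a x z.
Proof.
by move=> Vx Vz; have [+ _] := ba c Vx sV.1 Vz; rewrite !addr0 form0l // addr0.
Qed.

Lemma formZr c x z : V x -> V z -> a z (c *: x) = c * a z x.
Proof.
by move=> Vx Vz; have [_] := ba c Vx sV.1 Vz; rewrite !addr0 form0r // addr0.
Qed.

Lemma formBl x y z : V x -> V y -> V z -> a (x - y) z = a x z - a y z.
Proof.
move=> Vx Vy Vz; rewrite -scaleN1r formDl ?formZl ?mulN1r //.
exact: subspaceZ.
Qed.

Lemma form_suml s (c : nat -> R) (x : nat -> E) z : V z ->
  {in s, forall i, V (x i)} ->
  a (\sum_(i <- s) c i *: x i) z = \sum_(i <- s) c i * a (x i) z.
Proof.
move=> Vz; elim: s => [|i s IH] Vs; first by rewrite !big_nil form0l.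
have Vs' : {in s, forall i, V (x i)}.
  by move=> j sj; apply: Vs; rewrite inE sj orbT.
rewrite !big_cons (ba _ _ _ Vz).1 ?IH //; last exact: subspace_sum.
by apply: Vs; rewrite mem_head.
Qed.

Lemma form_sumr s (c : nat -> R) (x : nat -> E) z : V z ->
  {in s, forall i, V (x i)} ->
  a z (\sum_(i <- s) c i *: x i) = \sum_(i <- s) c i * a z (x i).
Proof.
move=> Vz; elim: s => [|i s IH] Vs; first by rewrite !big_nil form0r.
have Vs' : {in s, forall i, V (x i)}.
  by move=> j sj; apply: Vs; rewrite inE sj orbT.
rewrite !big_cons (ba _ _ _ Vz).2 ?IH //; last exact: subspace_sum.
by apply: Vs; rewrite mem_head.
Qed.

Hypothesis syma : symmetric_on V a.
Hypothesis a_ge0 : forall x, V x -> 0 <= a x x.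

Lemma form_square c x y : V x -> V y ->
  a (c *: y + x) (c *: y + x) = c ^+ 2 * a y y + 2 * c * a x y + a x x.
Proof.
move=> Vx Vy; have Vz : V (c *: y + x) by exact: sV.2.
rewrite (ba c Vy Vx Vz).1 (ba c Vy Vx Vy).2 (ba c Vy Vx Vx).2.
by rewrite (syma Vy Vx); ring.
Qed.

(** The quadratic function [c |-> a (c *: y + x) (c *: y + x)] is nonnegative. As [a] may be only
    semidefinite, [a y y = 0] is a separate case: the function is then affine in [c], which forces
    [a x y = 0]. *)
Lemma form_CS x y : V x -> V y -> a x y ^+ 2 <= a x x * a y y.
Proof.
move=> Vx Vy.
have q c : 0 <= c ^+ 2 * a y y + 2 * c * a x y + a x x.
  by rewrite -form_square //; apply: a_ge0; exact: sV.2.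
have := a_ge0 Vy; rewrite le_eqVlt => /predU1P[y0|y0].
  rewrite -y0 mulr0; have [->|xy0] := eqVneq (a x y) 0; first by rewrite expr0n.
  (* At this [c] the affine function takes the value -1. *)
  have := q (- (a x x + 1) / (2 * a x y)); rewrite -y0 mulr0 add0r.
  have -> : 2 * (- (a x x + 1) / (2 * a x y)) * a x y + a x x = -1 by field.
  lra.
(* The minimizer of the quadratic function. *)
have := q (- a x y / a y y).
have -> : (- a x y / a y y) ^+ 2 * a y y + 2 * (- a x y / a y y) * a x y + a x x =
   (a x x * a y y - a x y ^+ 2) / a y y by field; rewrite gt_eqF.
by rewrite pmulr_lge0 ?invr_gt0 // subr_ge0.
Qed.

Lemma form_norm_ge0 x : 0 <= form_norm a x.
Proof. exact: sqrtr_ge0. Qed.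

Lemma form_norm_sqr x : V x -> form_norm a x ^+ 2 = a x x.
Proof. by move=> Vx; rewrite sqr_sqrtr // a_ge0. Qed.

Lemma form_le_norm x y : V x -> V y -> a x y <= form_norm a x * form_norm a y.
Proof.
move=> Vx Vy; rewrite -sqrtrM ?a_ge0 //; apply: le_trans (ler_norm _) _.
by rewrite -sqrtr_sqr ler_wsqrtr // form_CS.
Qed.

Lemma form_norm_triangle x y : V x -> V y ->
  form_norm a (x + y) <= form_norm a x + form_norm a y.
Proof.
move=> Vx Vy; have Vxy : V (x + y) by exact: subspaceD.
rewrite -(@ler_pXn2r _ 2) ?nnegrE ?addr_ge0 ?form_norm_ge0 //.
rewrite form_norm_sqr // sqrrD !form_norm_sqr //.
rewrite formDl // !formDr // (syma Vy Vx).
by have := form_le_norm Vx Vy; lra.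
Qed.

End on_subspace.

Lemma sum_delta s (c : nat -> R) i : uniq s ->
  \sum_(j <- s) c j * (j == i)%:R = if i \in s then c i else 0.
Proof.
move=> us; case: ifPn => si.
  rewrite (bigD1_seq i) //= eqxx mulr1 big1 ?addr0 // => j /negbTE ->.
  by rewrite mulr0.
rewrite big_seq big1 // => j sj; case: eqP => [ji|_]; last by rewrite mulr0.
by rewrite -ji sj in si.
Qed.

(** * Eigenbases: expansion, Parseval identity, diagonalization *)

Section eigenpairs.
Variables (V : set E) (sV : subspace V) (a b : E -> E -> R).
Hypotheses (ba : bilinear_on V a) (bb : bilinear_on V b).
Variables (U : set E) (UV : U `<=` V) (N : nat) (lam : nat -> \bar R) (u : nat -> E).
Hypothesis eig : all_eigenpairs a b U N lam u.
Let s := index_iota 1 N.+1.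

Lemma eig_mem j : j \in s -> (1 <= j <= N)%N.
Proof. by rewrite mem_index_iota ltnS. Qed.

Lemma eig_in j : j \in s -> U (u j).
Proof. by case: eig => _ + _ _ => /(_ j) + /eig_mem js => /(_ js)[]. Qed.

Lemma eig_inV j : j \in s -> V (u j).
Proof. by move=> /eig_in /UV. Qed.

Lemma eig_eq j v : j \in s -> U v -> b (u j) v = rcp (lam j) * a (u j) v.
Proof. by case: eig => _ + _ _ => /(_ j) + /eig_mem js => /(_ js)[_ _]; apply. Qed.

Lemma eig_orth i j : i \in s -> j \in s -> a (u i) (u j) = (i == j)%:R.
Proof. by case: eig => _ _ _ + /eig_mem si /eig_mem sj; apply. Qed.

Lemma eig_subspace : subspace U.
Proof. by case: eig => /has_dim_subspace. Qed.

Lemma rcp_ge0 j : j \in s -> 0 <= rcp (lam j).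
Proof.
case: eig => _ + _ _ => /(_ j) + /eig_mem js => /(_ js)[lam0 _ _].
by rewrite /rcp fine_ge0 // inve_ge0 ltW.
Qed.

Lemma rcp_le i j : i \in s -> j \in s -> (i <= j)%N -> rcp (lam j) <= rcp (lam i).
Proof.
move=> si sj ij; have /andP[i1 _] := eig_mem si; have /andP[_ jN] := eig_mem sj.
case: eig => _ lam0 mon _.
have [li0 _ _] := lam0 i (eig_mem si); have [lj0 _ _] := lam0 j (eig_mem sj).
have ij' : (1 <= i <= j)%N by rewrite i1.
have lij := mon i j ij' jN.
(* Positive extended reals have finite inverses, that of [+oo] being 0, so [fine] preserves their
   order. *)
have fin (x : \bar R) : (0 < x)%E -> (x^-1)%E \is a fin_num.
  case: x => [x|_|//]; last by rewrite /= invey.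
  by rewrite lte_fin => x0; rewrite inver gt_eqF.
by rewrite /rcp fine_le ?fin // lee_pV2 // inE /= ltW.
Qed.

Lemma comb_coef t (c : nat -> R) i : uniq t -> {subset t <= s} -> i \in s ->
  a (\sum_(j <- t) c j *: u j) (u i) = if i \in t then c i else 0.
Proof.
move=> ut ts si; rewrite (form_suml sV ba _ (eig_inV si)); last by move=> j /ts /eig_inV.
rewrite -sum_delta //; apply: eq_big_seq => j /ts sj.
by rewrite eig_orth.
Qed.

(** Orthonormality makes the [u j] linearly independent, so their coordinate matrix [M] in a basis
    of [U] has a trivial left kernel. Being square, it is invertible, and coordinates in that basis
    convert to coordinates on the [u j]. *)
Lemma eig_expand v : U v -> v = \sum_(j <- s) a v (u j) *: u j.
Proof.
have us : uniq s by exact: iota_uniq.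
have shift (F : nat -> E) : \sum_(j <- s) F j = \sum_(i < N) F i.+1.
  by rewrite /s big_add1 big_mkord.
case: eig => -[e [_ defU]] _ _ _.
have sm (i : 'I_N) : i.+1 \in s by rewrite mem_index_iota /= ltnS ltn_ord.
have /choice[C HC] : forall i : 'I_N, exists c : 'I_N -> R, u i.+1 = \sum_j c j *: e j.
  move=> i; by have := eig_in (sm i); rewrite defU => -[c _ <-]; exists c.
pose M := \matrix_(i, j) C i j.
have comb (x : 'rV_N) : \sum_i x 0 i *: u i.+1 = \sum_j (x *m M) 0 j *: e j.
  under eq_bigr => i _ do rewrite HC scaler_sumr.
  rewrite exchange_big; apply: eq_bigr => j _; rewrite mxE scaler_suml.
  by apply: eq_bigr => i _; rewrite mxE scalerA.
have coef (x : 'rV_N) (k : 'I_N) : a (\sum_i x 0 i *: u i.+1) (u k.+1) = x 0 k.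
  (* The coefficients are moved from ['I_N] to the indices [1, ..., N]; [insub j.-1] undoes the
     shift. *)
  pose c j := if insub j.-1 is Some i then x 0 i else 0.
  have cE (i : 'I_N) : c i.+1 = x 0 i by rewrite /c /= valK.
  rewrite (_ : \sum_i _ = \sum_(j <- s) c j *: u j).
    by rewrite comb_coef // sm cE.
  by rewrite shift; apply: eq_bigr => i _; rewrite cE.
have Mu : M \in unitmx.
  rewrite -row_free_unit; apply: inj_row_free => x xM0; apply/rowP => k.
  rewrite -coef comb xM0 mxE big1; first by rewrite (form0l sV ba (eig_inV (sm k))).
  by move=> j _; rewrite mxE scale0r.
move=> Uv; move: (Uv); rewrite {1}defU => -[x _ vE].
pose y := \row_j x j *m invmx M.
have vy : v = \sum_i y 0 i *: u i.+1.
  rewrite comb mulmxKV // -vE; apply: eq_bigr => j _; by rewrite mxE.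
by rewrite shift {1}vy; apply: eq_bigr => i _; rewrite [in RHS]vy coef.
Qed.

(** Symmetry of [a] is a consequence of this identity and cannot be used here; expanding the second
    argument first gives [a (u j) w' = a w' (u j)]. *)
Lemma eig_parseval v w : U v -> U w ->
  a v w = \sum_(j <- s) a v (u j) * a w (u j).
Proof.
have uw j w' : j \in s -> U w' -> a (u j) w' = a w' (u j).
  move=> sj Uw'; have us : uniq s by exact: iota_uniq.
  rewrite {1}(eig_expand Uw') (form_sumr sV ba _ (eig_inV sj)); last by move=> i /eig_inV.
  have := sum_delta (fun i => a w' (u i)) j us; rewrite sj => <-; apply: eq_big_seq => i si.
  by rewrite eig_orth // eq_sym.
move=> Uv Uw; rewrite {1}(eig_expand Uv) (form_suml sV ba _ (UV Uw)).
  by apply: eq_big_seq => j sj; rewrite uw.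
by move=> j /eig_inV.
Qed.

Lemma eig_sym : symmetric_on U a.
Proof.
move=> v w Uv Uw; rewrite !eig_parseval //.
by apply: eq_bigr => j _; rewrite mulrC.
Qed.

Lemma eig_diag v w : U v -> U w ->
  b v w = \sum_(j <- s) rcp (lam j) * (a v (u j) * a w (u j)).
Proof.
move=> Uv Uw; rewrite {1}(eig_expand Uv) (form_suml sV bb _ (UV Uw)).
  apply: eq_big_seq => j sj; rewrite (eig_eq sj Uw) (eig_sym (eig_in sj) Uw).
  by rewrite mulrCA.
by move=> j /eig_inV.
Qed.

Lemma eig_symb : symmetric_on U b.
Proof.
move=> v w Uv Uw; rewrite !eig_diag //.
by apply: eq_bigr => j _; rewrite (mulrC (a v _)).
Qed.

Lemma eig_a_ge0 v : U v -> 0 <= a v v.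
Proof. by move=> Uv; rewrite eig_parseval // sumr_ge0 // => j _; rewrite -expr2 sqr_ge0. Qed.

Lemma eig_b_ge0 v : U v -> 0 <= b v v.
Proof.
move=> Uv; rewrite eig_diag // big_seq sumr_ge0 // => j sj.
by rewrite -expr2 mulr_ge0 ?sqr_ge0 // rcp_ge0.
Qed.

(** A Rayleigh quotient bound in which only the components present in [v] count, as suits vectors
    supported on a range of indices. *)
Lemma eig_b_le v m : U v -> 0 <= m ->
  {in s, forall j, a v (u j) != 0 -> rcp (lam j) <= m} -> b v v <= m * a v v.
Proof.
move=> Uv m0 lem; rewrite eig_diag // [a v v]eig_parseval // mulr_sumr.
rewrite !big_seq; apply: ler_sum => j sj; rewrite -expr2.
have [->|/(lem _ sj) le1] := eqVneq (a v (u j)) 0; first by rewrite expr0n !mulr0.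
by rewrite ler_wpM2r ?sqr_ge0.
Qed.

Lemma eig_b_ge v m : U v ->
  {in s, forall j, a v (u j) != 0 -> m <= rcp (lam j)} -> m * a v v <= b v v.
Proof.
move=> Uv lem; rewrite eig_diag // [a v v]eig_parseval // mulr_sumr.
rewrite !big_seq; apply: ler_sum => j sj; rewrite -expr2.
have [->|/(lem _ sj) le1] := eqVneq (a v (u j)) 0; first by rewrite expr0n !mulr0.
by rewrite ler_wpM2r ?sqr_ge0.
Qed.

End eigenpairs.
End forms.

(** * Definiteness of the energy form and comparison of eigenvalues *)

Section definiteness.
Variables (R : realType) (E : lmodType R).
Variables (V : set E) (sV : subspace V) (a b : E -> E -> R).
Hypotheses (ba : bilinear_on V a) (bb : bilinear_on V b).
Variables (N : nat) (lamb : nat -> \bar R) (ub : nat -> E).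
Hypothesis eigV : all_eigenpairs a b V N lamb ub.
Let VV : V `<=` V := fun _ => id.

Lemma eig_eq0 v : V v -> a v v = 0 -> v = 0.
Proof.
move=> Vv; rewrite (eig_parseval sV ba VV eigV Vv Vv) => /eqP.
rewrite psumr_eq0; last by move=> j _; rewrite -expr2 sqr_ge0.
move=> /allP a0; rewrite (eig_expand sV ba VV eigV Vv) big_seq big1 // => j sj.
by have := a0 j sj; rewrite /= -expr2 sqrf_eq0 => /eqP ->; rewrite scale0r.
Qed.

(** Uniqueness for variational equations; it turns the weak eigenvalue equation into an identity
    between vectors. *)
Lemma eig_inj v w : V v -> V w -> (forall z, V z -> a v z = a w z) -> v = w.
Proof.
move=> Vv Vw vw; have Vvw := subspaceB sV Vv Vw.
apply/eqP; rewrite -subr_eq0; apply/eqP; apply: eig_eq0 => //.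
by rewrite (formBl sV ba) // vw // subrr.
Qed.

Section min_max.
Variables (U : set E) (UV : U `<=` V) (N' : nat) (lam : nat -> \bar R) (u : nat -> E).
Hypothesis eigU : all_eigenpairs a b U N' lam u.

(* Some nonzero combination of u 1, ..., u j is a-orthogonal to ub 1, ..., ub (j-1);
   its Rayleigh quotient b / a separates the two eigenvalues. *)
Lemma rcp_min_max j : (1 <= j <= N')%N ->
  (j <= N)%N /\ rcp (lam j) <= rcp (lamb j).
Proof.
case: j => // k /andP[_ kN'].
pose M := \matrix_(p < k.+1, q < k) a (u p.+1) (ub q.+1).
(* [M] has one row more than it has columns. *)
have [x xM x0] : exists2 x : 'rV_k.+1, x *m M = 0 & x != 0.
  have : kermx M != 0.
    by rewrite -mxrank_eq0 mxrank_ker -lt0n subn_gt0 ltnS rank_leq_col.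
  by case/rowV0Pn => x /sub_kermxP xM x0; exists x.
pose c i : R := x 0 (inord i.-1); pose t := index_iota 1 k.+2.
have ut : uniq t by exact: iota_uniq.
have ts : {subset t <= index_iota 1 N'.+1}.
  move=> i; rewrite !mem_index_iota !ltnS => /andP[-> ik] /=.
  exact: leq_trans ik kN'.
pose v := \sum_(i <- t) c i *: u i.
have coef := comb_coef sV ba UV eigU c ut ts.
have Uv : U v.
  by apply: (subspace_sum (eig_subspace eigU)) => i /ts; apply: (eig_in eigU).
have Vv := UV Uv.
have av0 (q : 'I_k) : (q < N)%N -> a v (ub q.+1) = 0.
  move=> qN; have Vq : V (ub q.+1) by apply: (eig_in eigV); rewrite mem_index_iota.
  rewrite (form_suml sV ba _ Vq); last by move=> i /ts /(eig_in eigU) /UV.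
  transitivity ((x *m M) 0 q); last by rewrite xM mxE.
  rewrite mxE /t big_add1 /= big_mkord; apply: eq_bigr => p _.
  by rewrite !mxE /c /= inord_val.
have v0 : v != 0.
  apply: contra x0 => /eqP v0; apply/eqP/rowP => p; rewrite !mxE.
  have tp : p.+1 \in t by rewrite mem_index_iota /= ltnS ltn_ord.
  have := coef _ (ts _ tp); rewrite -/v v0 tp /c /= inord_val => <-.
  by rewrite (form0l sV ba) //; exact: (eig_inV UV eigU (ts _ tp)).
(* Otherwise [v] would be orthogonal to the whole eigenbasis of [V], hence zero. *)
have kN : (k < N)%N.
  rewrite ltnNge; apply/negP => Nk; move/eqP: v0; apply.
  rewrite (eig_expand sV ba VV eigV Vv) big_seq big1 // => i.
  rewrite mem_index_iota ltnS => /andP[i1 iN].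
  case: i i1 iN => // i _ iN; have ik : (i < k)%N by exact: leq_trans iN Nk.
  by rewrite (av0 (Ordinal ik)) // scale0r.
split=> //.
have avv : 0 < a v v.
  rewrite lt_neqAle (eig_a_ge0 sV ba VV eigV Vv) andbT eq_sym.
  by apply: contra v0 => /eqP /eig_eq0 ->.
(* On the [u] side [v] has components of index at most [k.+1] only, which bounds [b v v] from below;
   on the [ub] side it has components of index at least [k.+1] only, which bounds it from above. *)
rewrite -(ler_pM2r avv); apply: (@le_trans _ _ (b v v)).
  apply: (eig_b_ge sV ba bb UV eigU Uv) => i si; rewrite coef //.
  case: ifPn => [ti _|]; last by rewrite eqxx.
  apply: (rcp_le eigU) => //; first by rewrite mem_index_iota /= ltnS.
  by move: ti; rewrite mem_index_iota ltnS => /andP[].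
have sk : k.+1 \in index_iota 1 N.+1 by rewrite mem_index_iota.
apply: (eig_b_le sV ba bb VV eigV Vv); first exact: (rcp_ge0 eigV).
move=> i si avi; apply: (rcp_le eigV) => //; rewrite ltnNge; apply/negP => ik.
have /andP[i1 iN] := eig_mem si; case: i i1 iN {si} avi ik => // i _ iN + ik.
by rewrite (av0 (Ordinal ik)) // eqxx.
Qed.

End min_max.

(** * Duality estimate in the seminorm of [b] *)

Variables (W : set E) (eta : R).
Hypothesis WV : W `<=` V.
Hypothesis eta_ge0 : 0 <= eta.
(** Abstract form of the bound by [eta_a]: [z] is the discrete solution with datum [g]. The slack
    [eps] comes from the infimum over [W], for which only approximate minimizers are taken. *)
Hypothesis etaP : forall g, V g -> exists z, [/\ V z,
  (forall w, V w -> a z w = b g w) &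
  (forall eps, 0 < eps -> exists2 w, W w &
     form_norm a (z - w) <= eta * form_norm b g + eps)].

Let syma := eig_sym sV ba VV eigV.
Let symb := eig_symb sV ba bb VV eigV.
Let a_ge0 := eig_a_ge0 sV ba VV eigV.
Let b_ge0 := eig_b_ge0 sV ba bb VV eigV.

(** With [z] the solution for the datum [x] itself, [b x x = a z x = a (z - w) x] for every [w] in
    [W]. One factor [form_norm b x] then cancels, unless this seminorm vanishes. *)
Lemma aubin_nitsche x : V x -> (forall w, W w -> a x w = 0) ->
  form_norm b x <= eta * form_norm a x.
Proof.
move=> Vx xW; have [z [Vz zx app]] := etaP Vx.
have ax0 := form_norm_ge0 a x; have bx0 := form_norm_ge0 b x.
have key : form_norm b x ^+ 2 <= eta * form_norm b x * form_norm a x.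
  rewrite (form_norm_sqr b_ge0) // -zx //; apply/ler_addgt0Pr => eps eps0.
  (* The added 1 keeps the divisor positive when [form_norm a x] is 0. *)
  have d0 : 0 < form_norm a x + 1 by lra.
  have [w Ww wle] := app _ (divr_gt0 eps0 d0).
  have -> : a z x = a (z - w) x.
    by rewrite (formBl sV ba Vz (WV Ww) Vx) (syma (WV Ww) Vx) xW // subr0.
  apply: (le_trans (form_le_norm sV ba syma a_ge0 (subspaceB sV Vz (WV Ww)) Vx)).
  apply: (le_trans (ler_wpM2r ax0 wle)); rewrite mulrDl lerD2l.
  by rewrite mulrAC ler_pdivrMr // ler_wpM2l ?lerDl // ltW.
have [b0|bn0] := eqVneq (form_norm b x) 0; first by rewrite b0 mulr_ge0.
have bp : 0 < form_norm b x by rewrite lt_neqAle eq_sym bn0.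
by rewrite -(ler_pM2l bp) -expr2; apply: (le_trans key); rewrite mulrCA mulrA.
Qed.

(** * Galerkin and spectral projections of an eigenvector *)

Section projection.
Variables (U : set E) (UV : U `<=` V) (N' : nat) (lam : nat -> \bar R) (u : nat -> E).
Hypothesis eigU : all_eigenpairs a b U N' lam u.
Hypothesis WU : W `<=` U.
Variables (k : nat) (kN' : (k <= N')%N).
Variables (v : E) (Vv : V v) (mub : R).
Hypothesis v_eig : forall w, V w -> b v w = mub * a v w.
Variables (delta m : R) (delta_gt0 : 0 < delta) (m_ge0 : 0 <= m).
Hypothesis delta_le : forall j, (k < j <= N')%N -> delta <= `|rcp (lam j) - mub|.
Hypothesis le_m : forall j, (k < j <= N')%N -> rcp (lam j) <= m.

Let s := index_iota 1 N'.+1.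
Let t0 := index_iota 1 k.+1.
Let t := index_iota k.+1 N'.+1.
(** [proj s] is the a-orthogonal projection of [v] on [U]. It splits into the spectral projection
    [f] on the first [k] eigenvectors and the remainder [g]; [e] is the Galerkin error, so that
    [v - f = e + g]. *)
Let proj r := \sum_(j <- r) a v (u j) *: u j.
Let f := proj t0.
Let g := proj t.
Let e := v - proj s.

Let us : uniq s. Proof. exact: iota_uniq. Qed.
Let ut : uniq t. Proof. exact: iota_uniq. Qed.

Let ts : {subset t <= s}.
Proof.
move=> j; rewrite !mem_index_iota => /andP[kj ->]; rewrite andbT.
exact: leq_ltn_trans kj.
Qed.

Let t_range j : j \in t -> (k < j <= N')%N.
Proof. by rewrite mem_index_iota ltnS. Qed.

Let U_proj r : {subset r <= s} -> U (proj r).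
Proof. by move=> rs; apply: (subspace_sum (eig_subspace eigU)) => j /rs /(eig_in eigU). Qed.

Let Ug : U g. Proof. exact: U_proj. Qed.
Let Ve : V e. Proof. by apply: (subspaceB sV) => //; apply/UV/U_proj. Qed.
Let Vg : V g. Proof. exact: UV. Qed.

Let projs : proj s = f + g.
Proof. by rewrite /proj /s (big_cat_nat_idem _ (n := k.+1)) //= ?addr0. Qed.

Let vf : v - f = e + g.
Proof. by rewrite /e projs opprD addrA subrK. Qed.

Lemma galerkin_orth z : U z -> a e z = 0.
Proof.
move=> Uz; rewrite (eig_expand sV ba UV eigU Uz) (form_sumr sV ba _ Ve).
  rewrite big_seq big1 // => j sj; have Vj := eig_inV UV eigU sj.
  rewrite (formBl sV ba Vv (UV (U_proj (fun _ => id))) Vj).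
  by rewrite (comb_coef sV ba UV eigU _ us (fun _ => id) sj) sj subrr mulr0.
by move=> j; exact: (eig_inV UV eigU).
Qed.

(** [v - z] is the sum of [e] and of [proj s - z], a vector of [U] and thus orthogonal to [e]. *)
Lemma galerkin_best z : U z -> form_norm a e <= form_norm a (v - z).
Proof.
move=> Uz; have Uw := subspaceB (eig_subspace eigU) (U_proj (fun _ => id)) Uz.
rewrite ler_wsqrtr // (_ : v - z = e + (proj s - z)); last by rewrite addrA subrK.
move: (proj s - z) Uw => w Uw; have Vw := UV Uw; have Vew := subspaceD sV Ve Vw.
rewrite (formDl ba Ve Vw Vew) !(formDr ba Ve Vw) // (syma Vw Ve) (galerkin_orth Uw).
by rewrite add0r addr0 lerDl a_ge0.
Qed.

Let pythagoras : a (v - f) (v - f) = a e e + a g g.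
Proof.
rewrite vf (formDl ba Ve Vg (subspaceD sV Ve Vg)) (formDr ba Ve Vg Ve)
  (formDr ba Ve Vg Vg).
by rewrite (syma Vg Ve) (galerkin_orth Ug); rewrite add0r addr0.
Qed.

Let g_coef j : j \in s -> a g (u j) = if j \in t then a v (u j) else 0.
Proof. exact: (comb_coef sV ba UV eigU). Qed.

Let agg : a g g = \sum_(j <- t) a v (u j) ^+ 2.
Proof.
rewrite {1}/g (form_suml sV ba _ Vg); last by move=> j /ts /(eig_inV UV eigU).
apply: eq_big_seq => j tj; rewrite (syma _ Vg) ?g_coef ?ts // ?tj ?expr2 //.
exact: (eig_inV UV eigU (ts tj)).
Qed.

(** [b v (u j)] is evaluated by the eigenvalue of [v] and [b (proj s) (u j)] by that of [u j]; both
    come with the same factor [a v (u j)]. The components of [g] are thereby controlled by the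
    Galerkin error. *)
Let res j : j \in t -> (mub - rcp (lam j)) * a v (u j) = b e (u j).
Proof.
move=> tj; have sj := ts tj; have Vj := eig_inV UV eigU sj.
have VP := UV (U_proj (fun _ => id)).
rewrite (formBl sV bb) // v_eig // (symb VP Vj) (eig_eq eigU) //; last exact: U_proj.
rewrite (syma Vj VP) (comb_coef sV ba UV eigU _ us (fun _ => id) sj) sj.
by rewrite mulrBl.
Qed.

Let sigma := \sum_(j <- t) b e (u j) ^+ 2.

Let delta_g : delta ^+ 2 * a g g <= sigma.
Proof.
rewrite agg mulr_sumr /sigma !big_seq; apply: ler_sum => j tj.
rewrite -res // exprMn ler_wpM2r ?sqr_ge0 // -[leRHS]real_normK ?num_real //.
rewrite ler_pXn2r ?nnegrE ?(ltW delta_gt0) // distrC; exact/delta_le/t_range.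
Qed.

(** Bessel's inequality by duality: [z] satisfies [b e z = a z z = sigma] and [b z z <= m * sigma],
    so Cauchy-Schwarz gives [sigma ^+ 2 <= b e e * (m * sigma)]. The [u j] cannot be normalized in
    [b] instead, since [b (u j) (u j)] is 0 when [lam j = +oo]. *)
Let sigma_le : sigma <= m * b e e.
Proof.
have [s0|sn0] := eqVneq sigma 0; first by rewrite s0 mulr_ge0 ?b_ge0.
have sp : 0 < sigma.
  by rewrite lt_neqAle eq_sym sn0 sumr_ge0 // => j _; rewrite sqr_ge0.
pose z := \sum_(j <- t) b e (u j) *: u j.
have Uz : U z by apply: (subspace_sum (eig_subspace eigU)) => j /ts /(eig_in eigU).
have bez : b e z = sigma.
  rewrite (form_sumr sV bb _ Ve); last by move=> j /ts /(eig_inV UV eigU).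
  by apply: eq_bigr => j _; rewrite expr2.
have az j : j \in s -> a z (u j) = if j \in t then b e (u j) else 0.
  exact: (comb_coef sV ba UV eigU).
have azz : a z z = sigma.
  rewrite {1}/z (form_suml sV ba _ (UV Uz)); last by move=> j /ts /(eig_inV UV eigU).
  apply: eq_big_seq => j tj; rewrite (syma _ (UV Uz)) ?az ?ts // ?tj ?expr2 //.
  exact: (eig_inV UV eigU (ts tj)).
have bzz : b z z <= m * sigma.
  rewrite -azz; apply: (eig_b_le sV ba bb UV eigU Uz) => // j sj; rewrite az //.
  by case: ifPn => [tj _|]; [exact/le_m/t_range|rewrite eqxx].
have := form_CS sV bb symb b_ge0 Ve (UV Uz); rewrite bez => CS.
rewrite -(ler_pM2r sp) -expr2; apply: (le_trans CS).
by rewrite mulrAC mulrC ler_wpM2r ?b_ge0.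
Qed.

Let bgg : b g g <= m * a g g.
Proof.
apply: (eig_b_le sV ba bb UV eigU Ug) => // j sj; rewrite g_coef //.
by case: ifPn => [tj _|]; [exact/le_m/t_range|rewrite eqxx].
Qed.

Let an_e : form_norm b e <= eta * form_norm a e.
Proof. by apply: aubin_nitsche => // w /WU; exact: galerkin_orth. Qed.

Let bee_le : b e e <= eta ^+ 2 * a e e.
Proof.
rewrite -(form_norm_sqr b_ge0 Ve) -(form_norm_sqr a_ge0 Ve) -exprMn.
by rewrite ler_pXn2r ?nnegrE ?mulr_ge0 ?form_norm_ge0.
Qed.

(** By [pythagoras] only [a g g] has to be bounded, and [delta ^+ 2 * a g g <= sigma <= m * b e e <=
    m * eta ^+ 2 * a e e]. *)
Lemma spectral_projection_energy :
  form_norm a (v - f) <=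
  Num.sqrt (1 + eta ^+ 2 * m / delta ^+ 2) * form_norm a e.
Proof.
have d2 : 0 < delta ^+ 2 by rewrite exprn_gt0.
have c0 : 0 <= 1 + eta ^+ 2 * m / delta ^+ 2.
  by apply: addr_ge0 => //; apply: divr_ge0; [apply: mulr_ge0|]; rewrite ?sqr_ge0.
rewrite -sqrtrM // ler_wsqrtr // pythagoras mulrDl mul1r lerD2l.
rewrite -(ler_pM2l d2) mulrA mulrCA mulfV ?gt_eqF // mulr1.
apply: (le_trans delta_g); apply: (le_trans sigma_le).
by rewrite (mulrC (eta ^+ 2)) -mulrA ler_wpM2l.
Qed.

(** The ratio [m / delta] arises from [b g g <= m * a g g] and [delta ^+ 2 * a g g <= m * b e e].
    Duality applies to [e], which is orthogonal to [W], and [form_norm a e] is at most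
    [form_norm a (v - f)]. *)
Lemma spectral_projection_L2 :
  form_norm b (v - f) <= (1 + m / delta) * eta * form_norm a (v - f).
Proof.
(* [X] shields the right-hand side from the rewriting by [vf]. *)
set X := form_norm a (v - f); rewrite vf.
apply: (le_trans (form_norm_triangle sV bb symb b_ge0 Ve Vg)).
have eb0 := form_norm_ge0 b e.
have gb : form_norm b g <= m / delta * form_norm b e.
  have c0 : 0 <= m / delta by rewrite divr_ge0 // (ltW delta_gt0).
  rewrite -(@ler_pXn2r _ 2) ?nnegrE ?(mulr_ge0 c0) ?form_norm_ge0 //.
  rewrite exprMn !(form_norm_sqr b_ge0) //; apply: (le_trans bgg).
  have d2 : 0 < delta ^+ 2 by rewrite exprn_gt0.
  rewrite expr_div_n mulrAC ler_pdivlMr // -mulrA expr2 -mulrA.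
  rewrite ler_wpM2l // mulrC; exact: le_trans delta_g sigma_le.
rewrite -mulrA; apply: (@le_trans _ _ ((1 + m / delta) * form_norm b e)).
  by rewrite mulrDl mul1r lerD2l.
rewrite ler_wpM2l ?addr_ge0 ?divr_ge0 ?(ltW delta_gt0) //.
apply: (le_trans an_e); rewrite ler_wpM2l // ler_wsqrtr // pythagoras.
by rewrite lerDl a_ge0.
Qed.

End projection.
End definiteness.

(** * One step of the augmented subspace method *)

Section augmented_method.
Variables (R : realType) (E : lmodType R).

Lemma spectral_gap_le k N (lam : nat -> \bar R) (l : \bar R) j :
  (k < j <= N)%N -> spectral_gap k N lam l <= `|rcp (lam j) - rcp l|.
Proof.
move=> jN; apply: ge_inf; last by exists j.
by exists 0 => _ [i _ <-]; exact: normr_ge0.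
Qed.

(** Over an empty range of indices the infimum would be 0. *)
Lemma spectral_gap_gt0 k N (lam : nat -> \bar R) (l : \bar R) :
  0 < spectral_gap k N lam l -> (k < N)%N.
Proof.
rewrite ltnNge => d0; apply/negP => Nk; move: d0; rewrite /spectral_gap.
rewrite (_ : [set _ | _ in _] = set0) ?inf0 ?ltxx //.
apply/seteqP; split=> // _ [j /= /andP[kj jN] _].
by have := leq_trans kj (leq_trans jN Nk); rewrite ltnn.
Qed.

Lemma rcp_mul (l : \bar R) : (0 < l)%E -> (l < +oo)%E -> fine l * rcp l = 1 /\ 0 < fine l.
Proof.
case: l => [l| |] //; rewrite lte_fin => l0 _; split=> //.
by rewrite /rcp inver gt_eqF //= divff // gt_eqF.
Qed.

Variables (V W : set E) (a b : E -> E -> R).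
Hypotheses (ba : bilinear_on V a) (bb : bilinear_on V b).
Variables (N : nat) (lamb : nat -> \bar R) (ub : nat -> E).
Hypothesis eigV : all_eigenpairs a b V N lamb ub.
Hypotheses (WV : W `<=` V) (W0 : W 0).
Variable eta : R.
Hypothesis eta_ge0 : 0 <= eta.
Hypothesis etaP : forall g, V g -> exists z, [/\ V z,
  (forall w, V w -> a z w = b g w) &
  (forall eps, 0 < eps -> exists2 w, W w &
     form_norm a (z - w) <= eta * form_norm b g + eps)].
Variables (NW k : nat) (uhat : nat -> nat -> E) (lam : nat -> nat -> \bar R).
Variable u : nat -> nat -> E.
Hypothesis method : augmented_subspace_method a b V W NW k uhat lam u.
Variable F : nat -> E -> E.
Hypothesis F_ok : forall m, (1 <= m)%N -> is_spectral_projection a V k (u m) (F m).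

Let sV : subspace V. Proof. by case: eigV => /has_dim_subspace. Qed.
Let VV : V `<=` V := fun _ => id.
Let U m := augmented_space W k (uhat m).

Let eigU m : (1 <= m)%N -> all_eigenpairs a b (U m) (NW + k) (lam m) (u m).
Proof. by case: method => _ /(_ m) + m1 => /(_ m1)[]. Qed.

Let uhatV m i : (1 <= m)%N -> (1 <= i <= k)%N -> V (uhat m i).
Proof.
case: method => V1 step; case: m => // -[|m] _ ik; first exact: V1.
by have [//|_ _ /(_ i ik)[]] := step m.+1.
Qed.

Let UV m : (1 <= m)%N -> U m `<=` V.
Proof.
move=> m1 _ [w Ww [_ [c _ <-]] <-]; apply: (subspaceD sV (WV Ww)).
apply: (subspace_sum sV) => i; rewrite mem_index_iota ltnS => ik.
exact: uhatV.
Qed.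

Let WU m : W `<=` U m.
Proof.
move=> w Ww; exists w => //; exists 0; last by rewrite addr0.
by exists (fun=> 0) => //; apply: big1 => i _; rewrite scale0r.
Qed.

Let uhatU m (c : nat -> R) : U m (\sum_(1 <= i < k.+1) c i *: uhat m i).
Proof.
exists 0 => //; exists (\sum_(1 <= i < k.+1) c i *: uhat m i); last by rewrite add0r.
by exists c.
Qed.

Let kN : (k <= NW + k)%N. Proof. exact: leq_addl. Qed.

(** Orthonormality of the [u m i] reads the coefficients off the defining equations of [F m], so
    that [F m v] is the partial sum [f] of the projection estimates. *)
Let FE m v : (1 <= m)%N -> V v ->
  F m v = \sum_(1 <= i < k.+1) a v (u m i) *: u m i.
Proof.
move=> m1 Vv; have [[c _ cF] aF] := F_ok m1 Vv; rewrite -cF.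
apply: eq_big_seq => j tj; congr (_ *: _).
have jk : (1 <= j <= k)%N by move: tj; rewrite mem_index_iota ltnS.
rewrite -aF // -cF (comb_coef sV ba (UV m1) (eigU m1)) ?tj ?iota_uniq //.
  move=> i; rewrite !mem_index_iota !ltnS => /andP[-> ik] /=.
  exact: leq_trans ik kN.
by rewrite mem_index_iota ltnS; case/andP: jk => -> /leq_trans; apply.
Qed.

Variables (l i : nat) (l_ge1 : (1 <= l)%N) (i_k : (1 <= i <= k)%N).
Let delta m := spectral_gap k (NW + k) (lam m) (lamb i).
Hypothesis delta_gt0 : forall m, (1 <= m)%N -> 0 < delta m.
Let M := rcp (lamb k.+1).

Let kNW : (k < NW + k)%N.
Proof. exact: spectral_gap_gt0 (delta_gt0 l_ge1). Qed.

Let compare m j : (1 <= m)%N -> (1 <= j <= NW + k)%N ->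
  (j <= N)%N /\ rcp (lam m j) <= rcp (lamb j).
Proof. by move=> m1; apply: (rcp_min_max sV ba bb eigV (UV m1) (eigU m1)). Qed.

Let le_M m j : (1 <= m)%N -> (k < j <= NW + k)%N -> rcp (lam m j) <= M.
Proof.
move=> m1 /andP[kj jN]; have [//|_ leM] := @compare m k.+1 m1.
apply: le_trans leM; apply: (rcp_le (eigU m1)) => //; rewrite mem_index_iota ltnS //=.
by rewrite jN andbT (leq_ltn_trans _ kj).
Qed.

Let M_ge0 : 0 <= M.
Proof.
have [//|kN1 _] := @compare l k.+1 l_ge1.
by apply: (rcp_ge0 eigV); rewrite mem_index_iota ltnS.
Qed.

Let sub_i : i \in index_iota 1 N.+1.
Proof.
have /andP[i1 ik] := i_k; have iN : (1 <= i <= NW + k)%N.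
  by rewrite i1 (leq_trans ik).
by have [iN' _] := compare l_ge1 iN; rewrite mem_index_iota ltnS i1.
Qed.

Let lam_eq m j : (1 <= m)%N -> (1 <= j <= k)%N ->
  fine (lam m j) * rcp (lam m j) = 1 /\ 0 < fine (lam m j).
Proof.
move=> m1 jk; have [_ /(_ m m1)[_ /(_ j jk) fin _]] := method.
have [_ /(_ j) + _ _] := eigU m1; case/andP: (jk) => j1 jk' [|lam0 _ _].
  by rewrite j1 (leq_trans jk').
exact: rcp_mul.
Qed.

(** Finiteness of [lamb i] is inherited from [lam l i]: [rcp (lam l i)] is positive and at most
    [rcp (lamb i)] by min-max, whereas [rcp] is 0 at [+oo]. *)
Let lamb_eq : fine (lamb i) * rcp (lamb i) = 1 /\ 0 < fine (lamb i).
Proof.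
have [e0 p0] := lam_eq l_ge1 i_k; have /andP[i1 ik] := i_k.
have iN : (1 <= i <= NW + k)%N by rewrite i1 (leq_trans ik).
have [_ le1] := compare l_ge1 iN.
have r0 : 0 < rcp (lam l i) by rewrite -(pmulr_rgt0 _ p0) e0.
have [_ /(_ i) + _ _] := eigV => -[|lb0 _ _]; first exact: (eig_mem sub_i).
apply: rcp_mul => //; rewrite ltey; apply: contraTneq (lt_le_trans r0 le1) => ->.
by rewrite /rcp invey /= ltxx.
Qed.

Let v := ub i.
Let Vv : V v. Proof. exact: (eig_in eigV). Qed.
Let v_eig w : V w -> b v w = rcp (lamb i) * a v w.
Proof. exact: (eig_eq eigV). Qed.

Let energy m : (1 <= m)%N -> form_norm a (v - F m v) <=
  Num.sqrt (1 + eta ^+ 2 * M / delta m ^+ 2) *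
  form_norm a (v - \sum_(1 <= j < (NW + k).+1) a v (u m j) *: u m j).
Proof.
move=> m1; rewrite FE //.
apply: (spectral_projection_energy sV ba bb eigV WV eta_ge0 etaP (UV m1) (eigU m1)
  (@WU m) kN Vv v_eig (delta_gt0 m1) M_ge0) => j jk; last exact: le_M.
exact: spectral_gap_le.
Qed.

Let L2 m : (1 <= m)%N -> form_norm b (v - F m v) <=
  (1 + M / delta m) * eta * form_norm a (v - F m v).
Proof.
move=> m1; rewrite FE //.
apply: (spectral_projection_L2 sV ba bb eigV WV eta_ge0 etaP (UV m1) (eigU m1)
  (@WU m) kN Vv v_eig (delta_gt0 m1) M_ge0) => j jk; last exact: le_M.
exact: spectral_gap_le.
Qed.

Let V_F m : (1 <= m)%N -> V (F m v).
Proof.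
move=> m1; have [[c _ <-] _] := F_ok m1 Vv; apply: (subspace_sum sV) => j.
rewrite mem_index_iota ltnS => /andP[j1 jk]; apply: (eig_inV (UV m1) (eigU m1)).
by rewrite mem_index_iota ltnS j1 (leq_trans jk).
Qed.

(* The enriched space contains T_h (F l v), and v = lamb_i T_h v. *)
Let enrichment :
  form_norm a (v - \sum_(1 <= j < (NW + k).+1) a v (u l.+1 j) *: u l.+1 j) <=
  fine (lamb i) * (eta * form_norm b (v - F l v)).
Proof.
have Vf := V_F l_ge1; have [leq lp] := lamb_eq.
(* Division by [fine (lam l j)] cancels the eigenvalue on the right-hand side of the equation for
   [uhat l.+1 j]. *)
pose zf := \sum_(1 <= j < k.+1) (a v (u l j) / fine (lam l j)) *: uhat l.+1 j.
have Uzf : U l.+1 zf by exact: uhatU.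
have Vzf : V zf by exact: (UV (ltn0Sn l)).
have azf w : V w -> a zf w = b (F l v) w.
  move=> Vw; rewrite /zf (form_suml sV ba _ Vw); last first.
    by move=> j; rewrite mem_index_iota ltnS => jk; exact: uhatV.
  rewrite FE // (form_suml sV bb _ Vw); last first.
    move=> j; rewrite mem_index_iota ltnS => /andP[j1 jk].
    apply: (eig_inV (UV l_ge1) (eigU l_ge1)).
    by rewrite mem_index_iota ltnS j1 (leq_trans jk).
  apply: eq_big_seq => j; rewrite mem_index_iota ltnS => jk.
  have [_ /(_ l l_ge1)[_ _ /(_ j jk)[_ ->//]]] := method.
  have [_ p0] := lam_eq l_ge1 jk.
  by rewrite mulrA mulfVK // gt_eqF.
have Vg := subspaceB sV Vv Vf.
have [z [Vz az app]] := etaP Vg.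
have Vs := subspaceD sV Vzf Vz.
(* [zf] solves for the datum [F l v] and [z] for [v - F l v]; their sum solves for [v]. *)
have vE : v = fine (lamb i) *: (zf + z).
  apply: (eig_inj sV ba eigV Vv (subspaceZ sV _ Vs)) => w Vw.
  rewrite (formZl sV ba _ Vs Vw) (formDl ba Vzf Vz Vw) azf // az //.
  by rewrite (formBl sV bb Vv Vf Vw) addrC subrK v_eig // mulrA leq mul1r.
apply/ler_addgt0Pr => eps eps0.
have [w Ww wle] := app _ (divr_gt0 eps0 lp).
have Vw := WV Ww; have Uw := @WU l.+1 w Ww.
have sU := eig_subspace (eigU (ltn0Sn l)).
(* The competitor in the enriched space keeps [zf] exactly; only [z] is approximated. *)
pose y := fine (lamb i) *: (zf + w).
have Uy : U l.+1 y by apply: (subspaceZ sU); exact: (subspaceD sU).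
have Vzw := subspaceB sV Vz Vw.
have vy : v - y = fine (lamb i) *: (z - w).
  by rewrite vE /y -scalerBr opprD addrACA subrr add0r.
apply: (le_trans (galerkin_best sV ba eigV (UV (ltn0Sn l)) (eigU (ltn0Sn l)) Vv Uy)).
rewrite vy /form_norm (formZl sV ba _ Vzw (subspaceZ sV _ Vzw)) (formZr sV ba _ Vzw Vzw).
rewrite mulrA -expr2 sqrtrM ?sqr_ge0 // sqrtr_sqr gtr0_norm //.
apply: (le_trans (ler_wpM2l (ltW lp) wle)).
by rewrite mulrDr lerD2l mulrCA mulfV ?mulr1 // gt_eqF.
Qed.

(** Chains [energy] at level [l.+1], [enrichment], and [L2] at level [l]. The last two contribute
    one factor [eta] each. *)
Lemma augmented_subspace_contraction :
  form_norm a (ub i - F l.+1 (ub i)) <=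
  fine (lamb i) * Num.sqrt (1 + eta ^+ 2 * M / delta l.+1 ^+ 2) *
  (1 + M / delta l) * eta ^+ 2 * form_norm a (ub i - F l (ub i)).
Proof.
have [_ lp] := lamb_eq.
apply: (le_trans (energy (ltn0Sn l))).
apply: (le_trans (ler_wpM2l (sqrtr_ge0 _) enrichment)).
rewrite -!mulrA mulrCA ler_wpM2l ?(ltW lp) // ler_wpM2l ?sqrtr_ge0 //.
apply: (le_trans (ler_wpM2l eta_ge0 (L2 l_ge1))).
by rewrite le_eqVlt; apply/orP; left; apply/eqP; rewrite /v; ring.
Qed.

End augmented_method.

(** * Simplices and meshes *)

Section geometry_lemmas.
Variables (R : realType) (d : nat).
Notation pt := 'rV[R]_d.
Implicit Types (K L : {fset pt}) (x : pt).

Lemma dotDr (x y z : pt) : dot x (y + z) = dot x y + dot x z.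
Proof. by rewrite /dot -big_split; apply: eq_bigr => i _; rewrite mxE mulrDr. Qed.

Lemma dotZr c (x y : pt) : dot x (c *: y) = c * dot x y.
Proof. by rewrite /dot mulr_sumr; apply: eq_bigr => i _; rewrite mxE mulrCA. Qed.

Lemma dotC (x y : pt) : dot x y = dot y x.
Proof. by apply: eq_bigr => i _; rewrite mulrC. Qed.

Lemma dotDl (x y z : pt) : dot (x + y) z = dot x z + dot y z.
Proof. by rewrite dotC dotDr !(dotC z). Qed.

Lemma dotZl c (x y : pt) : dot (c *: x) y = c * dot x y.
Proof. by rewrite dotC dotZr dotC. Qed.

Lemma dot_sumr I (s : seq I) (F : I -> pt) (y : pt) :
  dot y (\sum_(i <- s) F i) = \sum_(i <- s) dot y (F i).
Proof.
elim: s => [|i s IH]; last by rewrite !big_cons dotDr IH.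
by rewrite !big_nil /dot big1 // => i _; rewrite mxE mulr0.
Qed.

Lemma sum_fset_nth (V : nmodType) n K (F : pt -> V) : #|` K| = n ->
  \sum_(p <- K) F p = \sum_(i < n) F (nth 0 K i).
Proof. by move=> <-; rewrite (big_nth 0) big_mkord. Qed.

Lemma rhull_hull K : rhull K `<=` hull K.
Proof. by move=> x [c [c0 c1 ->]]; exists c; split=> // p /c0 /ltW. Qed.

Lemma hull_bounded K x i : hull K x -> `|x 0 i| <= \sum_(p <- K) `|p 0 i|.
Proof.
case=> c [c0 c1 ->]; rewrite summxE.
apply: (le_trans (ler_norm_sum _ _ _)); rewrite !big_seq; apply: ler_sum => p pK.
rewrite mxE normrM ler_piMl ?normr_ge0 // ger0_norm ?c0 //.
rewrite -c1 (big_fsetD1 p) //= lerDl big_seq sumr_ge0 // => q.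
by rewrite !inE => /andP[_]; exact: c0.
Qed.

(** * Barycentric coordinates *)

Section barycentric.
Variables (K : {fset pt}) (cardK : #|` K| = d.+1) (affK : aff_indep K).

(** The leading coordinate 1 turns affine relations between the vertices into linear ones. *)
Definition vertex_mx : 'M[R]_(1 + d) :=
  \matrix_(i < 1 + d) row_mx (const_mx 1 : 'rV_1) (nth 0 K i).

Definition barycentric x : 'rV[R]_(1 + d) :=
  row_mx (const_mx 1 : 'rV_1) x *m invmx vertex_mx.

Lemma vertex_mxE (c : 'rV[R]_(1 + d)) :
  c *m vertex_mx =
  row_mx (const_mx (\sum_i c 0 i) : 'rV_1) (\sum_i c 0 i *: nth 0 K i).
Proof.
rewrite mulmx_sum_row -[RHS]/(row_mx _ _).
under eq_bigr do rewrite rowK.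
apply/rowP => j; rewrite summxE mxE; case: splitP => k jk.
  rewrite !mxE; apply: eq_bigr => i _; rewrite mxE (_ : j = lshift d k) ?row_mxEl ?mxE ?mulr1 //.
  exact: val_inj.
rewrite summxE; apply: eq_bigr => i _; rewrite mxE (_ : j = rshift 1 k) ?row_mxEr ?mxE //.
exact: val_inj.
Qed.

Lemma sum_index (V : lmodType R) (c : 'rV[R]_(1 + d)) (F : pt -> V) :
  \sum_(p <- K) c 0 (inord (index p K)) *: F p =
  \sum_(i < 1 + d) c 0 i *: F (nth 0 K i).
Proof.
rewrite (sum_fset_nth _ cardK); apply: eq_bigr => i _.
rewrite index_uniq ?fset_uniq //; last by rewrite cardK.
by rewrite inord_val.
Qed.

(** A vector of the left kernel is a family of coefficients of sum 0 that annihilates the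
    vertices. *)
Lemma vertex_mx_unit : vertex_mx \in unitmx.
Proof.
rewrite -row_free_unit; apply: inj_row_free => c; rewrite vertex_mxE => cM.
have [c1 c2] : \sum_i c 0 i = 0 /\ \sum_i c 0 i *: nth 0 K i = 0.
  have := cM; rewrite -[RHS](@row_mx0 _ 1 1 d) => /eq_row_mx[e1 e2]; split=> //.
  by have := congr1 (fun m : 'rV[R]_1 => m 0 0) e1; rewrite !mxE.
pose g p := c 0 (inord (index p K)).
have g1 : \sum_(p <- K) g p = 0.
  have := sum_index c (fun _ => 1 : R^o); rewrite /GRing.scale /=.
  by under eq_bigr do rewrite mulr1; under [RHS]eq_bigr do rewrite mulr1; rewrite c1.
have g2 : \sum_(p <- K) g p *: p = 0 by rewrite (sum_index c id).
apply/rowP => i; rewrite mxE.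
have iK : (i < size (enum_fset K))%N by rewrite cardK.
have := affK g1 g2 (mem_nth 0 iK); rewrite /g index_uniq ?fset_uniq //.
by rewrite inord_val.
Qed.

Lemma barycentric_unique x (c : 'rV[R]_(1 + d)) :
  \sum_i c 0 i = 1 -> x = \sum_i c 0 i *: nth 0 K i -> barycentric x = c.
Proof.
move=> c1 ->; rewrite /barycentric -c1 -vertex_mxE mulmxK //.
exact: vertex_mx_unit.
Qed.

(** Replaces the existential in [rhull] by finitely many strict affine inequalities, which makes
    [rhull K] measurable. *)
Lemma rhull_barycentric : rhull K = [set x | forall i, 0 < barycentric x 0 i].
Proof.
apply/seteqP; split=> x /=.
  case=> c [c0 c1 xE] i.
  rewrite (@barycentric_unique x (\row_i c (nth 0 K i))).
  - by rewrite mxE c0 // mem_nth // cardK.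
  - by rewrite -c1 (sum_fset_nth _ cardK); apply: eq_bigr => j _; rewrite mxE.
  - by rewrite xE (sum_fset_nth _ cardK); apply: eq_bigr => j _; rewrite mxE.
move=> b0; have := vertex_mxE (barycentric x).
rewrite /barycentric mulmxKV ?vertex_mx_unit // -/(barycentric x).
move=> /eq_row_mx[e1 e2]; exists (fun p => barycentric x 0 (inord (index p K))); split.
- by move=> p _; exact: b0.
- have := sum_index (barycentric x) (fun _ => 1 : R^o); rewrite /GRing.scale /=.
  under eq_bigr do rewrite mulr1; under [X in _ = X -> _]eq_bigr do rewrite mulr1.
  by move=> ->; have := congr1 (fun m : 'rV[R]_1 => m 0 0) e1; rewrite !mxE.
- by rewrite (sum_index _ id).
Qed.

(** The column [(- beta, nu)] lies in the kernel of the invertible [vertex_mx]. *)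
Lemma hyperplane_eq0 (nu : pt) beta : (forall p, p \in K -> dot nu p = beta) -> nu = 0.
Proof.
move=> nuK; pose y : 'cV[R]_(1 + d) := col_mx (const_mx (- beta) : 'cV_1) nu^T.
have y0 : vertex_mx *m y = 0.
  apply/row_matrixP => i; rewrite row_mul row0 rowK mul_row_col.
  apply/rowP => j; rewrite !mxE big_ord1 !mxE mul1r.
  have iK : nth 0 K i \in K by rewrite mem_nth // cardK.
  rewrite -(nuK _ iK) /dot; apply/eqP; rewrite addrC subr_eq0; apply/eqP.
  by apply: eq_bigr => k _; rewrite mxE mulrC ord1.
have {}y0 : y = 0 by rewrite -[y](mulKmx vertex_mx_unit) y0 mulmx0.
have := congr1 (@dsubmx R 1 d 1) y0; rewrite /y col_mxKd => /(congr1 trmx).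
by rewrite trmxK => ->; apply/rowP => i; rewrite !mxE.
Qed.

End barycentric.

(** The point lies in the hull of the common vertices. Its coordinates in [K] are unique and all
    positive, so every vertex of [K] is common; equal cardinalities conclude. *)
Lemma rhull_disjoint (Omega : set pt) (T : {fset {fset pt}}) K L x :
  is_mesh Omega T -> K \in T -> L \in T -> rhull K x -> rhull L x -> K = L.
Proof.
move=> [Tok Tcap _] KT LT.
have sub K' L' : K' \in T -> L' \in T -> rhull K' x -> rhull L' x -> (K' `<=` L')%fset.
  move=> KT' LT' Kx Lx; have [cK aK] := Tok _ KT'.
  have : hull (K' `&` L')%fset x.
    by rewrite -Tcap //; split; apply: rhull_hull.
  have [c [c0 c1 xc]] := Kx.
  case=> c' [c'0 c'1 xc'].
  (* The difference of two affine representations of [x], the second one extended by 0. *)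
  pose g p := c p - (if p \in L' then c' p else 0).
  have split (V : nmodType) (F : pt -> V) :
      \sum_(p <- (K' `&` L')%fset) F p = \sum_(p <- K') (if p \in L' then F p else 0).
    rewrite -big_mkcond -[RHS]big_filter; apply: perm_big; apply: uniq_perm.
    - exact: fset_uniq.
    - by rewrite filter_uniq ?fset_uniq.
    - by move=> p; rewrite mem_filter !inE andbC.
  have g1 : \sum_(p <- K') g p = 0 by rewrite sumrB c1 -split c'1 subrr.
  have g2 : \sum_(p <- K') g p *: p = 0.
    under eq_bigr do rewrite scalerBl; rewrite sumrB -xc xc' split.
    apply/eqP; rewrite subr_eq0; apply/eqP; apply: eq_bigr => p _.
    by case: ifP => _; rewrite ?scale0r.
  apply/fsubsetP => p pK; have := aK g g1 g2 p pK; rewrite /g.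
  by case: ifP => // _; rewrite subr0 => cp0; have := c0 p pK; rewrite cp0 ltxx.
move=> Kx Lx; have [cK _] := Tok _ KT; have [cL _] := Tok _ LT.
by apply/eqP; rewrite eqEfcard sub //= cK cL.
Qed.

Lemma closure_halfspace (nu : pt) beta :
  closure [set x | dot nu x < beta] `<=` [set x | dot nu x <= beta].
Proof.
have cont : continuous (dot nu).
  apply: (@continuous_big _ _ +%R 0 xpredT _ _ _ (fun i (x : pt) => nu 0 i * x 0 i)).
    exact: add_continuous.
  move=> i _ x; apply: (@continuous_comp _ _ _ (fun x : pt => x 0 i) ( *%R (nu 0 i))).
    exact: coord_continuous.
  exact: mulrl_continuous.
have -> : [set x | dot nu x <= beta] = closure [set x | dot nu x <= beta].
  apply/closure_id; apply: (@preimage_closed _ _ (dot nu) [set y | y <= beta]).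
    by move=> x _; exact: cont.
  exact: closed_le.
by apply: closureS => x /ltW.
Qed.

Lemma closure_polyhedron m (nu : 'I_m -> pt) (beta : 'I_m -> R) i :
  closure [set x | forall i, dot (nu i) x < beta i] `<=`
  [set x | dot (nu i) x <= beta i].
Proof.
by move=> x xO; apply: closure_halfspace; apply: closureS xO => y; apply.
Qed.

(** * Position of the cells in the domain *)

Section in_domain.
Variables (Omega : set pt) (T : {fset {fset pt}}).
Hypotheses (Omega_poly : convex_polyhedral_domain Omega) (T_mesh : is_mesh Omega T).

Lemma hull_closure K : K \in T -> hull K `<=` closure Omega.
Proof. by move=> KT x xK; case: T_mesh => _ _ <-; exists K. Qed.

(* A point of rhull K on a supporting hyperplane of Omega would put all d + 1
   vertices of K on this hyperplane. *)
Lemma rhull_domain K : K \in T -> rhull K `<=` Omega.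
Proof.
move=> KT x xK; have [cK aK] : #|` K| = d.+1 /\ aff_indep K by case: T_mesh => + _ _; apply.
case: Omega_poly => _ _ [m [nu [beta [nu0 OE]]]]; rewrite OE => i /=.
have cl y : hull K y -> dot (nu i) y <= beta i.
  by move=> /(hull_closure KT); rewrite OE; exact: closure_polyhedron.
have := cl x (rhull_hull xK); rewrite le_eqVlt => /predU1P[xb|//].
have vert p : p \in K -> hull K p.
  move=> pK; exists (fun q => (q == p)%:R); split=> [q _||].
  - exact: ler0n.
  - rewrite (big_fsetD1 p) //= eqxx big_seq big1 ?addr0 // => q.
    by rewrite !inE => /andP[/negbTE ->].
  - rewrite (big_fsetD1 p) //= eqxx scale1r big_seq big1 ?addr0 // => q.
    by rewrite !inE => /andP[/negbTE ->]; rewrite scale0r.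
case: xK => c [c0 c1 xE].
(* The slacks at the vertices are nonnegative and have a zero average with positive weights, so each
   of them is 0. *)
have sum0 : \sum_(p <- K) c p * (beta i - dot (nu i) p) = 0.
  under eq_bigr do rewrite mulrBr; rewrite sumrB -mulr_suml c1 mul1r -xb xE dot_sumr.
  by apply/eqP; rewrite subr_eq0; apply/eqP; apply: eq_bigr => p _; rewrite dotZr.
have on p : p \in K -> dot (nu i) p = beta i.
  move=> pK; have ge0 q : q \in K -> 0 <= c q * (beta i - dot (nu i) q).
    by move=> qK; rewrite mulr_ge0 ?(ltW (c0 _ qK)) // subr_ge0 cl //; exact: vert.
  move: sum0; rewrite (big_fsetD1 p) //= => /eqP; rewrite paddr_eq0 ?ge0 //.
    rewrite mulf_eq0 gt_eqF ?c0 //= => /andP[/eqP e _].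
    by apply/eqP; rewrite eq_sym -subr_eq0 e.
  by rewrite big_seq sumr_ge0 // => q; rewrite !inE => /andP[_]; exact: ge0.
by have := nu0 i; rewrite (hyperplane_eq0 cK aK on) eqxx.
Qed.

Lemma domain_bounded x i : Omega x ->
  `|x 0 i| <= \sum_(K <- T) \sum_(p <- K) `|p 0 i|.
Proof.
move=> /subset_closure; case: T_mesh => _ _ <- -[K /= KT xK].
apply: (le_trans (hull_bounded i xK)).
by rewrite (big_fsetD1 K) //= lerDl sumr_ge0 // => L _; rewrite sumr_ge0.
Qed.

End in_domain.
End geometry_lemmas.

(** * Integration *)

Section ess_bounded.
Context {dsp : measure_display} {T : measurableType dsp} {R : realType}.
Variable mu : {measure set T -> \bar R}.
Implicit Types (D : set T) (f g : T -> R).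

(** Stable under sums and products and integrable on sets of finite measure, this class contains
    polynomials on bounded sets, the components of weak functions, and the entries of [A], whose
    bound holds almost everywhere. *)
Definition ess_bounded D f :=
  measurable_fun D f /\ exists M : R, {ae mu, forall x, D x -> `|f x| <= M}.

Lemma bounded_ess_bounded D f M : measurable_fun D f ->
  (forall x, D x -> `|f x| <= M) -> ess_bounded D f.
Proof. by move=> mf fM; split=> //; exists M; apply: aeW. Qed.

Lemma ess_bounded_cst D c : ess_bounded D (fun=> c).
Proof. by apply: (@bounded_ess_bounded _ _ `|c|) => //; exact: measurable_cst. Qed.

Lemma ess_boundedD D f g :
  ess_bounded D f -> ess_bounded D g -> ess_bounded D (fun x => f x + g x).
Proof.
move=> [mf [M fM]] [mg [M' gM]]; split; first exact: measurable_funD.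
exists (M + M'); apply: filterS2 fM gM => x fM gM Dx.
by apply: (le_trans (ler_normD _ _)); apply: lerD; [exact: fM|exact: gM].
Qed.

Lemma ess_boundedM D f g :
  ess_bounded D f -> ess_bounded D g -> ess_bounded D (fun x => f x * g x).
Proof.
move=> [mf [M fM]] [mg [M' gM]]; split; first exact: measurable_funM.
exists (M * M'); apply: filterS2 fM gM => x fM gM Dx.
by rewrite normrM ler_pM ?fM ?gM.
Qed.

Lemma ess_boundedZ D c f : ess_bounded D f -> ess_bounded D (fun x => c * f x).
Proof. by apply: ess_boundedM; exact: ess_bounded_cst. Qed.

Lemma ess_boundedX D f n : ess_bounded D f -> ess_bounded D (fun x => f x ^+ n).
Proof.
move=> bf; elim: n => [|n IH]; first exact: ess_bounded_cst.
by under eq_fun do rewrite exprS; exact: ess_boundedM.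
Qed.

Lemma ess_bounded_sum D (I : eqType) (s : seq I) (h : I -> T -> R) :
  {in s, forall i, ess_bounded D (h i)} -> ess_bounded D (fun x => \sum_(i <- s) h i x).
Proof.
elim: s => [|i s IH] bh.
  by under eq_fun do rewrite big_nil; exact: ess_bounded_cst.
under eq_fun do rewrite big_cons; apply: ess_boundedD.
  by apply: bh; rewrite mem_head.
by apply: IH => j sj; apply: bh; rewrite inE sj orbT.
Qed.

Lemma ess_bounded_prod D I (s : seq I) (h : I -> T -> R) :
  (forall i, ess_bounded D (h i)) -> ess_bounded D (fun x => \prod_(i <- s) h i x).
Proof.
move=> bh; elim: s => [|i s IH].
  by under eq_fun do rewrite big_nil; exact: ess_bounded_cst.
by under eq_fun do rewrite big_cons; exact: ess_boundedM.
Qed.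

Lemma eq_ess_bounded D f g :
  (forall x, D x -> f x = g x) -> ess_bounded D f -> ess_bounded D g.
Proof.
move=> fg [mf [M fM]]; split.
  by apply: eq_measurable_fun mf => x; rewrite inE => /fg.
by exists M; apply: filterS fM => x fM Dx; rewrite -fg // fM.
Qed.

Lemma sub_ess_bounded D D' f : measurable D -> D' `<=` D ->
  ess_bounded D f -> ess_bounded D' f.
Proof.
move=> mD DD [mf [M fM]]; split; first exact: measurable_funS mf.
by exists M; apply: filterS fM => x fM /DD.
Qed.

(** [X] is the identity for cells and an affine parametrization for faces. *)
Lemma ess_bounded_pfun n (D : set T) (X : T -> 'rV[R]_n) (p : mpoly n R) :
  (forall i, ess_bounded D (fun s => X s 0 i)) -> ess_bounded D (fun s => pfun p (X s)).
Proof.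
move=> bX; rewrite /pfun; under eq_fun do rewrite mevalE.
apply: ess_bounded_sum => m _; apply: ess_boundedZ; apply: ess_bounded_prod => i.
exact: ess_boundedX.
Qed.

Lemma ess_bounded_integrable D f : measurable D -> (mu D < +oo)%E ->
  ess_bounded D f -> mu.-integrable D (EFin \o f).
Proof.
move=> mD Doo [mf [M fM]]; have mEf := (measurable_EFinP _ _).2 mf.
apply/integrableP; split=> //.
apply: (@le_lt_trans _ _ (\int[mu]_(x in D) (`|M|)%:E)%E).
  apply: ae_ge0_le_integral => //.
  - exact: measurableT_comp.
  - apply: filterS fM => x fM Dx; rewrite /= lee_fin.
    by rewrite (le_trans (fM Dx)) // ler_norm.
by rewrite integral_cst // lte_mul_pinfty // lee_fin.
Qed.

Section integrals.
Variables (D : set T) (mD : measurable D) (Doo : (mu D < +oo)%E).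

Lemma Rintegral_lin c f g : ess_bounded D f -> ess_bounded D g ->
  \int[mu]_(x in D) (c * f x + g x) = c * \int[mu]_(x in D) f x + \int[mu]_(x in D) g x.
Proof.
move=> bf bg; rewrite RintegralD ?RintegralZl //; apply: ess_bounded_integrable => //.
exact: ess_boundedZ.
Qed.

Lemma Rintegral_sum (I : eqType) (s : seq I) (h : I -> T -> R) :
  {in s, forall i, ess_bounded D (h i)} ->
  \int[mu]_(x in D) (\sum_(i <- s) h i x) = \sum_(i <- s) \int[mu]_(x in D) h i x.
Proof.
elim: s => [|i s IH] bh.
  by rewrite big_nil; under eq_Rintegral do rewrite big_nil; rewrite Rintegral_cst // mul0r.
have bs : {in s, forall j, ess_bounded D (h j)}.
  by move=> j sj; apply: bh; rewrite inE sj orbT.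
rewrite big_cons -IH // -[X in X + _]mul1r -Rintegral_lin.
- by apply: eq_Rintegral => x _; rewrite big_cons mul1r.
- by apply: bh; rewrite mem_head.
- exact: ess_bounded_sum.
Qed.

(** A zero integral of [f x ^+ 2] forces [f], hence [g * f], to vanish almost everywhere. *)
Lemma Rintegral_mul_eq0 f g : ess_bounded D f -> ess_bounded D g ->
  \int[mu]_(x in D) f x ^+ 2 = 0 -> \int[mu]_(x in D) (g x * f x) = 0.
Proof.
move=> bf bg f20.
have bf2 := ess_boundedX 2 bf.
have mE h : ess_bounded D h -> measurable_fun D (EFin \o h).
  by case=> mh _; exact/measurable_EFinP.
have /(ae_eq_integral_abs mu mD (mE _ bf2)) f0 :
    (\int[mu]_(x in D) `|(EFin \o (fun x => f x ^+ 2)%R) x| = 0)%E.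
  have -> : (\int[mu]_(x in D) `|(EFin \o (fun x => f x ^+ 2)%R) x| =
      \int[mu]_(x in D) (f x ^+ 2)%:E)%E.
    by apply: eq_integral => x _ /=; rewrite ger0_norm ?sqr_ge0.
  (* As [fine +oo = 0], a zero real integral could hide an infinite one; integrability excludes
     this. *)
  have /fineK <- := integrable_fin_num mD (ess_bounded_integrable mD Doo bf2).
  by rewrite [fine _]f20.
rewrite /Rintegral (@ae_eq_integral _ _ _ mu D (cst 0%E)) //; first by rewrite integral0.
  exact/mE/ess_boundedM.
apply: filterS f0 => x f0 Dx; have [/eqP] := f0 Dx.
by rewrite sqrf_eq0 => /eqP ->; rewrite mulr0.
Qed.

End integrals.
End ess_bounded.

(** * Borel sets and Lebesgue measure of row vectors *)

Section row_vectors.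
Variable R : realType.

Lemma measurable_forall_gt0 {dsp} {T : measurableType dsp} n (f : 'I_n -> T -> R) :
  (forall i, measurable_fun setT (f i)) ->
  measurable [set x | forall i, 0 < f i x].
Proof.
move=> mf; rewrite (_ : [set x | _] = \bigcap_(i in setT) (f i @^-1` `]0, +oo[)).
  apply: fin_bigcap_measurable => //.
  by move=> i _; rewrite -[X in measurable X]setTI; apply: mf => //; exact: measurable_itv.
by apply/seteqP; split=> x /= fx i; [move=> _|]; have := fx i; rewrite /= in_itv /= andbT //; apply.
Qed.

Lemma measurable_affine n (b : R) (c : 'I_n -> R) :
  measurable_fun [set: 'rV[R]_n] (fun x => b + \sum_i c i * x 0 i).
Proof.
apply: measurable_funD; first exact: measurable_cst.
apply: measurable_sum => i; apply: measurable_funM; first exact: measurable_cst.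
exact: measurable_rV_coord.
Qed.

Definition box n (M : R) : set 'rV[R]_n := [set x | forall i, `|x 0 i| <= M].

Lemma measurable_box n M : measurable (@box n M).
Proof.
rewrite (_ : @box n M = \bigcap_(i in setT) ((fun x => x 0 i) @^-1` `[- M, M])).
  apply: fin_bigcap_measurable => //.
  move=> i _; rewrite -[X in measurable X]setTI.
  by apply: (@measurable_rV_coord _ R n i) => //; exact: measurable_itv.
apply/seteqP; split=> x /= bx i; first by move=> _; rewrite /= in_itv /= -ler_norml.
by have := bx i I; rewrite /= in_itv /= -ler_norml.
Qed.

(** Through [rV_cons] the box is the product of an interval and a box of lower dimension; in
    dimension 0 the measure is a Dirac mass. *)
Lemma lebesgue_box n M : (lebesgue_rV R n (@box n M) < +oo)%E.
Proof.
elim: n => [|n IH].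
  rewrite /= diracE; apply: (@le_lt_trans _ _ 1%E); last exact: ltry.
  by rewrite lee_fin lern1; case: (_ \in _).
rewrite (_ : lebesgue_rV R n.+1 (@box n.+1 M) =
  (lebesgue_measure \x lebesgue_rV R n)%E (`[- M, M]%classic `*` @box n M)); last first.
  rewrite /= /lebesgue_rVS /pushforward; congr (product_measure1 _ _ _).
  apply/seteqP; split=> -[a x] /=.
    move=> bx; split; first by have := bx ord0; rewrite rV_cons0 /= in_itv /= ler_norml.
    by move=> i; have := bx (lift ord0 i); rewrite rV_consS.
  move=> [am bx] i; case: (unliftP ord0 i) => [j ->|->]; first by rewrite rV_consS; exact: bx.
  by rewrite rV_cons0 /=; move: am; rewrite in_itv /= -ler_norml.
rewrite product_measure1E //; last exact: measurable_box.
apply: lte_mul_pinfty => //.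
have fin : lebesgue_measure (`[- M, M]%classic : set R) \is a fin_num.
  by rewrite lebesgue_measure_itv /=; case: ifP.
exact: fin.
Qed.

Lemma bounded_finite_measure n (D : set 'rV[R]_n) M : measurable D -> D `<=` @box n M ->
  (lebesgue_rV R n D < +oo)%E.
Proof.
move=> mD DM; apply: le_lt_trans (lebesgue_box n M).
by apply: le_measure; rewrite ?inE //; exact: measurable_box.
Qed.

Lemma ess_bounded_coord n (D : set 'rV[R]_n) M i : D `<=` @box n M ->
  ess_bounded (lebesgue_rV R n) D (fun x => x 0 i).
Proof.
move=> DM; apply: (@bounded_ess_bounded _ _ _ _ _ _ M); last by move=> x /DM.
apply: (measurable_funS measurableT); first by [].
exact: measurable_rV_coord.
Qed.

Lemma measurable_simplex n : measurable (@ref_simplex R n).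
Proof.
rewrite (_ : @ref_simplex R n = [set s : 'rV[R]_n | forall i, 0 < s 0 i] `&`
   [set s | forall i : 'I_1, 0 < 1 + \sum_i (- 1) * s 0 i]); last first.
  apply/seteqP; split=> s /=.
    by case=> s0 s1; split=> // _; rewrite -mulr_sumr mulN1r subr_gt0.
  by case=> s0 /(_ ord0); rewrite -mulr_sumr mulN1r subr_gt0.
apply: measurableI; apply: measurable_forall_gt0 => i; last exact: measurable_affine.
exact: measurable_rV_coord.
Qed.

Lemma simplex_box n : @ref_simplex R n `<=` @box n 1.
Proof.
move=> s [s0 s1] i; rewrite gtr0_norm //; apply: le_trans (ltW s1).
by rewrite (bigD1 i) //= lerDl sumr_ge0 // => j _; rewrite ltW.
Qed.

Lemma measurable_domain d (Omega : set 'rV[R]_d) :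
  convex_polyhedral_domain Omega -> measurable Omega.
Proof.
case=> _ _ [m [nu [beta [_ ->]]]].
have e (x : 'rV[R]_d) i : beta i + \sum_j (- nu i 0 j) * x 0 j = beta i - dot (nu i) x.
  by rewrite /dot -sumrN; congr (_ + _); apply: eq_bigr => j _; rewrite mulNr.
have := @measurable_forall_gt0 _ _ m _ (fun i => measurable_affine (beta i) (fun j => - nu i 0 j)).
congr measurable; apply/seteqP; split=> x /= H i; have := H i.
  by rewrite e subr_gt0.
by rewrite -subr_gt0 e.
Qed.

Lemma measurable_rhull d (K : {fset 'rV[R]_d}) : #|` K| = d.+1 -> aff_indep K ->
  measurable (rhull K).
Proof.
move=> cK aK; rewrite (rhull_barycentric cK aK).
apply: (@measurable_forall_gt0 _ _ (1 + d) (fun i x => barycentric K x 0 i)) => i.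
have -> : (fun x => barycentric K x 0 i) = (fun x =>
    invmx (vertex_mx K) (lshift d 0) i +
    \sum_j invmx (vertex_mx K) (rshift 1 j) i * x 0 j).
  apply/funext => x; rewrite /barycentric mxE big_split_ord /= big_ord1.
  rewrite row_mxEl mxE mul1r; congr (_ + _); apply: eq_bigr => j _.
  by rewrite row_mxEr mulrC.
exact: measurable_affine.
Qed.

Lemma rhull_box d (K : {fset 'rV[R]_d}) :
  rhull K `<=` @box d (\sum_i \sum_(p <- K) `|p 0 i|).
Proof.
move=> x /rhull_hull xK i; apply: (le_trans (hull_bounded i xK)).
by rewrite (bigD1 i) //= lerDl !sumr_ge0 // => j _; rewrite sumr_ge0.
Qed.

End row_vectors.

(** * The weak Galerkin forms *)

Section cells.
Variables (R : realType) (d : nat) (K : {fset 'rV[R]_d}).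
Hypotheses (cardK : #|` K| = d.+1) (affK : aff_indep K).
Notation mu := (lebesgue_rV R d).

Lemma rhull_finite_measure : (mu (rhull K) < +oo)%E.
Proof. by apply: bounded_finite_measure (@rhull_box _ _ K); exact: measurable_rhull. Qed.

Lemma ess_bounded_rhull_pfun (p : mpoly d R) : ess_bounded mu (rhull K) (pfun p).
Proof.
by apply: (ess_bounded_pfun (X := id)) => i; apply: ess_bounded_coord (@rhull_box _ _ K).
Qed.

End cells.

(** * Affine parametrization of faces *)

Section faces.
Variables (R : realType) (d : nat) (e : {fset 'rV[R]_d}).
Hypothesis carde : #|` e| = d.-1.+1.
Notation mu' := (lebesgue_rV R d.-1).

Definition face_param (s : 'rV[R]_d.-1) : 'rV[R]_d :=
  nth 0 e 0%N + \sum_i s 0 i *: (nth 0 e i.+1 - nth 0 e 0%N).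

(** [face_integral] thus evaluates its integrand in the relative interior of [e], where [v.2] is
    known to be a polynomial. *)
Lemma face_paramP s : @ref_simplex R d.-1 s -> rhull e (face_param s).
Proof.
move=> [s0 s1].
(* The vertex of index 0 receives what the reference coordinates leave of the total weight 1. *)
pose c (i : nat) : R := if i is j.+1 then (if insub j is Some k then s 0 k else 0)
  else 1 - \sum_k s 0 k.
have cS (k : 'I_d.-1) : c k.+1 = s 0 k by rewrite /c valK.
have cnth i : (i < d.-1.+1)%N -> c (index (nth 0 e i) e) = c i.
  by move=> ie; rewrite index_uniq ?fset_uniq // carde.
exists (fun p => c (index p e)); split.
- move=> p pe; have : (index p e < d.-1.+1)%N by rewrite -carde index_mem.
  case: (index p e) => [|j] je; first by rewrite /= subr_gt0.
  by rewrite (cS (Ordinal (je : (j < d.-1)%N))).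
- rewrite (sum_fset_nth _ carde) big_ord_recl cnth //.
  under eq_bigr => k _ do rewrite lift0 cnth ?ltnS ?ltn_ord // cS.
  by rewrite subrK.
- rewrite (sum_fset_nth _ carde) big_ord_recl cnth //.
  under [X in _ + X]eq_bigr => k _ do rewrite lift0 cnth ?ltnS ?ltn_ord // cS.
  rewrite /face_param (eq_bigr (fun i : 'I_d.-1 =>
    s 0 i *: nth 0 e i.+1 - s 0 i *: nth 0 e 0%N)); last by move=> i _; rewrite scalerBr.
  by rewrite sumrB -scaler_suml scalerBl scale1r addrA addrAC.
Qed.

Lemma ess_bounded_face_pfun (p : mpoly d R) :
  ess_bounded mu' (@ref_simplex R d.-1) (fun s => pfun p (face_param s)).
Proof.
apply: ess_bounded_pfun => j.
apply: (@eq_ess_bounded _ _ _ _ _ (fun s : 'rV[R]_d.-1 => nth 0 e 0%N 0 j +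
    \sum_(i < d.-1) (nth 0 e i.+1 - nth 0 e 0%N) 0 j * s 0 i)).
  move=> s _; rewrite /face_param mxE summxE; congr (_ + _).
  by apply: eq_bigr => i _; rewrite [in RHS]mxE mulrC.
apply: ess_boundedD; first exact: ess_bounded_cst.
apply: ess_bounded_sum => i _; apply: ess_boundedZ.
exact: ess_bounded_coord (@simplex_box _ _).
Qed.

Lemma face_integral_lin c (f g : 'rV[R]_d -> R) :
  ess_bounded mu' (@ref_simplex R d.-1) (f \o face_param) ->
  ess_bounded mu' (@ref_simplex R d.-1) (g \o face_param) ->
  face_integral e (fun x => c * f x + g x) = c * face_integral e f + face_integral e g.
Proof.
move=> bf bg; rewrite /face_integral /=.
rewrite (@Rintegral_lin _ _ _ mu' _ (@measurable_simplex _ _) _ c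
  (f \o face_param) (g \o face_param)) //.
  by rewrite mulrDr mulrCA.
by apply: bounded_finite_measure (@simplex_box _ _); exact: measurable_simplex.
Qed.

End faces.

Section Gspace.
Variables (R : realType) (d r t : nat).

Lemma Poly_le_lin n (c : R) (p q : mpoly d R) :
  Poly_le n p -> Poly_le n q -> Poly_le n (c *: p + q).
Proof.
rewrite /Poly_le /= => pn qn; apply: (leq_trans (msizeD_le _ _)).
by rewrite geq_max qn andbT (leq_trans (msizeZ_le _ _)).
Qed.

Lemma Gspace_lin (c : R) (p q : pfield R d) : Gspace r t p -> Gspace r t q ->
  Gspace r t (fun i => c *: p i + q i).
Proof.
rewrite /Gspace; case: ifP => _ /=.
  move=> [p0 [ph [p0r phh pE]]] [q0 [qh [q0r qhh qE]]].
  exists (fun i => c *: p0 i + q0 i), (c *: ph + qh); split.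
  - by move=> i; exact: Poly_le_lin.
  - by apply: rpredD => //; exact: rpredZ.
  - by move=> i; rewrite pE qE mulrDl -scalerAl scalerDr addrACA.
by move=> pr qr i; exact: Poly_le_lin.
Qed.

End Gspace.

(** * Bilinearity of [b_h] and [a_h] *)

Section weak_galerkin_forms.
Variables (R : realType) (d : nat) (d_gt0 : (0 < d)%N).
Notation mu := (lebesgue_rV R d).
Variables (Omega : set 'rV[R]_d) (Omega_poly : convex_polyhedral_domain Omega).
Variables (A : 'rV[R]_d -> 'M[R]_d) (c C : R) (A_ok : diffusion_tensor Omega A c C).
Variables (Th : {fset {fset 'rV[R]_d}}) (Th_mesh : is_mesh Omega Th).
Variables (r t : nat) (grad : wfun R d -> {fset 'rV[R]_d} -> pfield R d).
Let Vh := WGspace Omega Th r t.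
Hypothesis sV : subspace Vh.
Hypothesis grad_ok : is_weak_gradient Th r t Vh grad.

Let cell K : K \in Th -> #|` K| = d.+1 /\ aff_indep K.
Proof. by case: Th_mesh => + _ _; apply. Qed.

Let mcell K : K \in Th -> measurable (rhull K).
Proof. by move=> /cell[cK aK]; exact: measurable_rhull. Qed.

Let fcell K : K \in Th -> (mu (rhull K) < +oo)%E.
Proof. by move=> /cell[cK aK]; exact: rhull_finite_measure. Qed.

Let bcell K (p : mpoly d R) : K \in Th -> ess_bounded mu (rhull K) (pfun p).
Proof. by move=> _; exact: ess_bounded_rhull_pfun. Qed.

Lemma ess_bounded_interior K v : K \in Th -> Vh v -> ess_bounded mu (rhull K) v.1.
Proof.
move=> KT [/(_ K KT)[p _ vp] _ _ _ _].
by apply: eq_ess_bounded (bcell p KT) => x /vp.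
Qed.

Lemma b_h_bilinear : bilinear_on Vh (b_h Th).
Proof.
have sym u v : b_h Th u v = b_h Th v u.
  by apply: eq_bigr => K _; apply: eq_Rintegral => x _; rewrite mulrC.
have left k x y z : Vh x -> Vh y -> Vh z ->
    b_h Th (k *: x + y) z = k * b_h Th x z + b_h Th y z.
  move=> Vx Vy Vz; rewrite /b_h mulr_sumr -big_split; apply: eq_big_seq => K KT /=.
  have bx := ess_bounded_interior KT Vx; have by_ := ess_bounded_interior KT Vy.
  have bz := ess_bounded_interior KT Vz.
  rewrite -(Rintegral_lin (mcell KT) (fcell KT) _ (ess_boundedM bx bz) (ess_boundedM by_ bz)).
  by apply: eq_Rintegral => p _ /=; rewrite mulrDl -mulrA.
by move=> k x y z Vx Vy Vz; rewrite left // !(sym z) left.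
Qed.

Section vector_fields.
Variables (K : {fset 'rV[R]_d}) (KT : K \in Th).
Implicit Types P Q : 'rV[R]_d -> 'rV[R]_d.

Definition ess_bounded_field P := forall i, ess_bounded mu (rhull K) (fun x => P x 0 i).

Definition cell_energy P Q : R :=
  \int[mu]_(x in rhull K) dot (P x *m (A x)^T) (Q x).

(** The bounds on [A] hold in [Omega], which contains the open cells. *)
Let bA i j : ess_bounded mu (rhull K) (fun x => A x i j).
Proof.
have [mA AM _ _] := A_ok.
apply: (sub_ess_bounded (measurable_domain Omega_poly) (rhull_domain Omega_poly Th_mesh KT)).
by split; [exact: mA|exact: AM].
Qed.

Lemma ess_bounded_dot P Q : ess_bounded_field P -> ess_bounded_field Q ->
  ess_bounded mu (rhull K) (fun x => dot (P x) (Q x)).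
Proof. by move=> bP bQ; apply: ess_bounded_sum => i _; exact: ess_boundedM. Qed.

Let bPA P : ess_bounded_field P -> ess_bounded_field (fun x => P x *m (A x)^T).
Proof.
move=> bP i; under eq_fun do rewrite mxE; apply: ess_bounded_sum => j _.
by under eq_fun do rewrite mxE; exact: ess_boundedM.
Qed.

Lemma cell_energy_linl k P P' Q :
  ess_bounded_field P -> ess_bounded_field P' -> ess_bounded_field Q ->
  cell_energy (fun x => k *: P x + P' x) Q = k * cell_energy P Q + cell_energy P' Q.
Proof.
move=> bP bP' bQ; rewrite /cell_energy -(Rintegral_lin (mcell KT) (fcell KT)).
- by apply: eq_Rintegral => x _; rewrite mulmxDl -scalemxAl dotDl dotZl.
- exact: ess_bounded_dot (bPA bP) bQ.
- exact: ess_bounded_dot (bPA bP') bQ.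
Qed.

Lemma cell_energy_linr k P P' Q :
  ess_bounded_field P -> ess_bounded_field P' -> ess_bounded_field Q ->
  cell_energy Q (fun x => k *: P x + P' x) = k * cell_energy Q P + cell_energy Q P'.
Proof.
move=> bP bP' bQ; rewrite /cell_energy -(Rintegral_lin (mcell KT) (fcell KT)).
- by apply: eq_Rintegral => x _; rewrite dotDr dotZr.
- exact: ess_bounded_dot (bPA bQ) bP.
- exact: ess_bounded_dot (bPA bQ) bP'.
Qed.

Section null_field.
Variable P : 'rV[R]_d -> 'rV[R]_d.
Hypotheses (bP : ess_bounded_field P)
  (P0 : \int[mu]_(x in rhull K) dot (P x) (P x) = 0).

Let comp0 i : \int[mu]_(x in rhull K) (P x 0 i ^+ 2) = 0.
Proof.
apply/eqP; rewrite eq_le Rintegral_ge0; last by move=> x _; rewrite sqr_ge0.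
rewrite andbT -P0; apply: (le_Rintegral (mcell KT)).
- by apply: ess_bounded_integrable (mcell KT) (fcell KT) _; exact: ess_boundedX.
- by apply: ess_bounded_integrable (mcell KT) (fcell KT) _; exact: ess_bounded_dot.
- move=> x _; rewrite /dot (bigD1 i) //= -expr2 lerDl sumr_ge0 // => j _.
  by rewrite -expr2 sqr_ge0.
Qed.

Let null Q : ess_bounded_field Q -> \int[mu]_(x in rhull K) dot (Q x) (P x) = 0.
Proof.
move=> bQ; rewrite (Rintegral_sum (mcell KT) (fcell KT)).
  by apply: big1 => i _; apply: (Rintegral_mul_eq0 (mcell KT) (fcell KT)).
by move=> i _; exact: ess_boundedM.
Qed.

Lemma cell_energy0r Q : ess_bounded_field Q -> cell_energy Q P = 0.
Proof. by move=> bQ; apply: null; exact: bPA. Qed.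

(** Exchanging the double sum moves the matrix to the other factor: [dot (P x *m (A x)^T) (Q x) =
    dot (Q x *m A x) (P x)]. *)
Lemma cell_energy0l Q : ess_bounded_field Q -> cell_energy P Q = 0.
Proof.
move=> bQ; have bAQ : ess_bounded_field (fun x => Q x *m A x).
  move=> i; under eq_fun do rewrite mxE; apply: ess_bounded_sum => j _.
  exact: ess_boundedM.
rewrite -(null bAQ); apply: eq_Rintegral => x _; rewrite /dot.
under eq_bigr do rewrite mxE mulr_suml; under [RHS]eq_bigr do rewrite mxE mulr_suml.
rewrite exchange_big; apply: eq_bigr => i _; apply: eq_bigr => j _.
by rewrite mxE; ring.
Qed.

End null_field.
End vector_fields.

Lemma pfun_lin k (p q : mpoly d R) x : pfun (k *: p + q) x = k * pfun p x + pfun q x.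
Proof. by rewrite /pfun mevalD mevalZ. Qed.

Lemma field_at_lin k (p q : pfield R d) x :
  field_at (fun i => k *: p i + q i) x = k *: field_at p x + field_at q x.
Proof. by apply/rowP => i; rewrite !mxE pfun_lin. Qed.

Let bfield K (q : pfield R d) : K \in Th -> ess_bounded_field K (field_at q).
Proof. by move=> KT i; under eq_fun do rewrite mxE; exact: bcell. Qed.

Definition weak_gradient_rhs (K : {fset 'rV[R]_d}) (q : pfield R d) (v : wfun R d) : R :=
  - \int[mu]_(x in rhull K) (v.1 x * div_at q x) +
  \sum_(p <- K) face_integral (K `\ p)%fset
    (fun x => v.2 x * dot (field_at q x) (outward_normal K p)).

Lemma weak_gradient_rhs_lin K q k u v : K \in Th -> Vh u -> Vh v ->
  weak_gradient_rhs K q (k *: u + v) =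
  k * weak_gradient_rhs K q u + weak_gradient_rhs K q v.
Proof.
move=> KT Vu Vv; have [cK aK] := cell KT.
have bu := ess_bounded_interior KT Vu; have bv := ess_bounded_interior KT Vv.
have bq : ess_bounded mu (rhull K) (div_at q) by exact: bcell.
have e1 : \int[mu]_(x in rhull K) ((k *: u + v).1 x * div_at q x) =
  k * \int[mu]_(x in rhull K) (u.1 x * div_at q x) +
  \int[mu]_(x in rhull K) (v.1 x * div_at q x).
  rewrite -(Rintegral_lin (mcell KT) (fcell KT) _ (ess_boundedM bu bq) (ess_boundedM bv bq)).
  by apply: eq_Rintegral => p _ /=; rewrite mulrDl -mulrA.
have e2 p : p \in K ->
  let phi w := face_integral (K `\ p)%fset
    (fun x => w.2 x * dot (field_at q x) (outward_normal K p)) in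
  phi (k *: u + v) = k * phi u + phi v.
  move=> pK phi; rewrite /phi.
  (* Positivity of [d] makes [d.-1.+1] the number of vertices of a face. *)
  have ce : #|` (K `\ p)%fset| = d.-1.+1.
    by move: cK; rewrite (cardfsD1 p) pK add1n prednK // => -[].
  have be w : Vh w -> ess_bounded (lebesgue_rV R d.-1) (@ref_simplex R d.-1)
      ((fun x => w.2 x * dot (field_at q x) (outward_normal K p)) \o face_param (K `\ p)%fset).
    have pe : mesh_faces Th (K `\ p)%fset by exists K; exists p; split.
    move=> [_ _ /(_ _ pe)[pw _ wp] _ _].
    apply: (@ess_boundedM _ _ _ _ _ (w.2 \o face_param (K `\ p)%fset)
      (fun s => dot (field_at q (face_param (K `\ p)%fset s)) (outward_normal K p))).
      apply: eq_ess_bounded (ess_bounded_face_pfun (K `\ p)%fset pw) => s sS /=.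
      by rewrite wp //; exact: face_paramP.
    apply: ess_bounded_sum => i _; apply: ess_boundedM; last exact: ess_bounded_cst.
    by under eq_fun do rewrite mxE; exact: ess_bounded_face_pfun.
  rewrite -(face_integral_lin k (be u Vu) (be v Vv)) //; congr face_integral.
  by apply/funext => x /=; rewrite mulrDl -mulrA.
rewrite /weak_gradient_rhs e1 (eq_big_seq _ e2) big_split /= -mulr_sumr; ring.
Qed.

(* is_weak_gradient only determines grad u K by its inner products with G_r(K), so
   grad is linear up to a field of G_r(K) whose square integrates to 0. *)
Definition gradient_defect k u v K : pfield R d :=
  fun i => (-1) *: (k *: grad u K i + grad v K i) + grad (k *: u + v) K i.

(** The defect lies in [Gspace r t] and can be tested against itself; the right-hand sides of the
    three defining identities then cancel by linearity. *)
Lemma gradient_defect_null k u v K : K \in Th -> Vh u -> Vh v ->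
  \int[mu]_(x in rhull K) dot (field_at (gradient_defect k u v K) x)
                              (field_at (gradient_defect k u v K) x) = 0.
Proof.
move=> KT Vu Vv; have Vw := sV.2 k u v Vu Vv.
have [Gu gu] := grad_ok Vu KT; have [Gv gv] := grad_ok Vv KT.
have [Gw gw] := grad_ok Vw KT.
have GD : Gspace r t (gradient_defect k u v K).
  by apply: Gspace_lin => //; exact: Gspace_lin.
set q := gradient_defect k u v K in GD *.
have lin kk (p p' : pfield R d) :
  \int[mu]_(x in rhull K) dot (field_at (fun i => kk *: p i + p' i) x) (field_at q x) =
  kk * \int[mu]_(x in rhull K) dot (field_at p x) (field_at q x) +
  \int[mu]_(x in rhull K) dot (field_at p' x) (field_at q x).
  rewrite -(Rintegral_lin (mcell KT) (fcell KT)); last 2 first.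
  - by apply: ess_bounded_dot; exact: bfield.
  - by apply: ess_bounded_dot; exact: bfield.
  by apply: eq_Rintegral => x _; rewrite field_at_lin dotDl dotZl.
rewrite {1}/q /gradient_defect !lin (gu q GD) (gv q GD) (gw q GD).
by rewrite -!/(weak_gradient_rhs K q _) weak_gradient_rhs_lin //; ring.
Qed.

(** [grad (k *: x + y) K] is the combination of the two gradients plus the defect, which contributes
    0 to the energy in either argument. *)
Lemma a_h_bilinear : bilinear_on Vh (a_h Th A grad).
Proof.
move=> k x y z Vx Vy Vz; rewrite /a_h !mulr_sumr -!big_split /=.
pose f v K : 'rV[R]_d -> 'rV[R]_d := field_at (grad v K).
have bf v K : K \in Th -> ess_bounded_field K (f v K) by exact: bfield.
have split K : f (k *: x + y) K = fun p => 1 *: field_at (gradient_defect k x y K) p +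
    (k *: f x K p + f y K p).
  by apply/funext => p; rewrite !field_at_lin /f scale1r scaleN1r addrAC addNr add0r.
split; apply: eq_big_seq => K KT; have bD := bfield (gradient_defect k x y K) KT;
  have D0 := gradient_defect_null k KT Vx Vy; rewrite -!/(cell_energy K (f _ K) (f _ K)) split.
- rewrite (cell_energy_linl KT 1 bD) ?(cell_energy0l KT bD D0) ?mulr0 ?add0r.
  + by rewrite cell_energy_linl //; exact: bf.
  + exact: bf.
  + move=> i; under eq_fun do rewrite mxE mxE.
    by apply: ess_boundedD; [apply: ess_boundedZ|]; exact: bf.
  + exact: bf.
- rewrite (cell_energy_linr KT 1 bD) ?(cell_energy0r KT bD D0) ?mulr0 ?add0r.
  + by rewrite cell_energy_linr //; exact: bf.
  + exact: bf.
  + move=> i; under eq_fun do rewrite mxE mxE.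
    by apply: ess_boundedD; [apply: ess_boundedZ|]; exact: bf.
  + exact: bf.
Qed.

End weak_galerkin_forms.

(** * Interior parts as functions on the domain *)

Section interior_integrals.
Variables (R : realType) (d : nat).
Notation mu := (lebesgue_rV R d).
Variables (Omega : set 'rV[R]_d) (Omega_poly : convex_polyhedral_domain Omega).
Variables (Th : {fset {fset 'rV[R]_d}}) (Th_mesh : is_mesh Omega Th).
Variables (r t : nat).
Let Vh := WGspace Omega Th r t.

Let mO : measurable Omega := measurable_domain Omega_poly.

Let Omega_box : exists M, Omega `<=` @box R d M.
Proof.
exists (\sum_(i < d) \sum_(K <- Th) \sum_(p <- K) `|p 0 i|).
move=> x Ox i; apply: (le_trans (domain_bounded Th_mesh i Ox)).
rewrite [leRHS](bigD1 i) //= lerDl sumr_ge0 // => j _.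
by apply: sumr_ge0 => K _; apply: sumr_ge0.
Qed.

Let fO : (mu Omega < +oo)%E.
Proof. by have [M OM] := Omega_box; exact: bounded_finite_measure OM. Qed.

(** The open cells are pairwise disjoint and [v.1] is 0 off their union, so this holds at every
    point, the mesh skeleton included. *)
Lemma interior_decomposition v x : Vh v ->
  v.1 x = \sum_(K <- Th) \1_(rhull K) x * v.1 x.
Proof.
case=> _ v0 _ _ _; have [[K /= KT xK]|xN] := pselect (cells_dom Th x); last first.
  by rewrite v0 // big1 // => K _; rewrite mulr0.
rewrite (big_fsetD1 K) //= indicE mem_set // mul1r big_seq big1 ?addr0 // => L.
rewrite !inE => /andP[LK LT]; rewrite indicE memNset ?mul0r // => xL.
by move: LK; rewrite (rhull_disjoint Th_mesh KT LT xK xL) eqxx.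
Qed.

Let b_indic K : K \in Th -> ess_bounded mu Omega (\1_(rhull K) : _ -> R).
Proof.
move=> KT; apply: (@bounded_ess_bounded _ _ _ _ _ _ 1).
  apply: measurable_indic; case: Th_mesh => /(_ _ KT)[cK aK] _ _.
  exact: measurable_rhull.
by move=> x _; rewrite indicE normr_nat lern1; case: (_ \in _).
Qed.

Let b_indic_interior K v : K \in Th -> Vh v ->
  ess_bounded mu Omega (fun x => \1_(rhull K) x * v.1 x).
Proof.
move=> KT [/(_ K KT)[p _ vp] _ _ _ _]; have [M OM] := Omega_box.
apply: (@eq_ess_bounded _ _ _ _ _ (fun x => \1_(rhull K) x * pfun p x)).
  move=> x _; rewrite indicE; have [xK|xK] := pselect (rhull K x).
    by rewrite vp.
  by rewrite memNset // !mul0r.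
apply: (ess_boundedM (b_indic KT)); apply: (ess_bounded_pfun (X := id)) => i.
exact: ess_bounded_coord OM.
Qed.

Lemma ess_bounded_domain v : Vh v -> ess_bounded mu Omega v.1.
Proof.
move=> Vv; apply: (@eq_ess_bounded _ _ _ _ _
  (fun x => \sum_(K <- Th) \1_(rhull K) x * v.1 x)).
  by move=> x _; rewrite -interior_decomposition.
by apply: ess_bounded_sum => K KT; exact: b_indic_interior.
Qed.

Lemma b_hf_interior v w : Vh v -> Vh w -> b_hf Omega v.1 w = b_h Th v w.
Proof.
move=> Vv Vw; have bw := ess_bounded_domain Vw.
rewrite /b_hf (@eq_Rintegral _ _ _ mu Omega
  (fun x => \sum_(K <- Th) \1_(rhull K) x * v.1 x * w.1 x)).
  rewrite (Rintegral_sum mO fO).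
    apply: eq_big_seq => K KT.
    rewrite -{2}(setIidr (rhull_domain Omega_poly Th_mesh KT)) Rintegral_mkcondr.
    apply: eq_Rintegral => x _; rewrite patchE indicE.
    by case: ifP => xK; rewrite ?mul1r ?mul0r.
  by move=> K KT; apply: ess_boundedM bw; exact: b_indic_interior.
by move=> x _; rewrite {1}(interior_decomposition x Vv) mulr_suml.
Qed.

Lemma L2fun_interior c v : Vh v -> L2fun Omega (fun x => c * v.1 x).
Proof.
move=> Vv; have bv := ess_boundedZ c (ess_bounded_domain Vv); split; first exact: bv.1.
exact: ess_bounded_integrable mO fO (ess_boundedX 2 bv).
Qed.

Lemma b_hf_scale c v w : Vh v -> Vh w -> b_hf Omega (fun x => c * v.1 x) w = c * b_h Th v w.
Proof.
move=> Vv Vw; rewrite -b_hf_interior // /b_hf -RintegralZl //.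
  by apply: eq_Rintegral => x _; rewrite mulrA.
apply: (ess_bounded_integrable mO fO).
by apply: ess_boundedM; exact: ess_bounded_domain.
Qed.

Lemma L2norm_interior c v : Vh v -> 0 <= c ->
  L2norm Omega (fun x => c * v.1 x) = c * form_norm (b_h Th) v.
Proof.
move=> Vv c0; rewrite /L2norm /form_norm -b_hf_interior //.
have bv := ess_bounded_domain Vv.
rewrite (@eq_Rintegral _ _ _ mu Omega (fun x => c ^+ 2 * (v.1 x * v.1 x))); last first.
  by move=> x _; rewrite exprMn -expr2.
rewrite RintegralZl //; last first.
  by apply: (ess_bounded_integrable mO fO); exact: ess_boundedM.
by rewrite sqrtrM ?sqr_ge0 // sqrtr_sqr ger0_norm.
Qed.

(** Integrates [m * (f x - m^-1 * v.1 x) ^+ 2 >= 0]. It serves to bound the supremum in [eta_a],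
    where [f] is an arbitrary function of [L^2(Omega)]. *)
Lemma b_hf_young f v (m : R) : 0 < m -> Vh v -> L2fun Omega f -> L2norm Omega f = 1 ->
  2 * b_hf Omega f v <= m + m^-1 * b_h Th v v.
Proof.
move=> m0 Vv [mf if2] f1; have bv := ess_bounded_domain Vv.
have iv2 : mu.-integrable Omega (EFin \o (fun x => v.1 x * v.1 x)).
  by apply: (ess_bounded_integrable mO fO); exact: ess_boundedM.
have ifv : mu.-integrable Omega (EFin \o (fun x => f x * v.1 x)).
  apply: (@le_integrable _ _ _ _ _ _ _ (fun x => ((f x ^+ 2)%:E + (v.1 x * v.1 x)%:E)%E)) => //.
  - by apply/measurable_EFinP; apply: measurable_funM => //; case: bv.
  - move=> x _; rewrite /= lee_fin -expr2.
    rewrite [leRHS]ger0_norm ?addr_ge0 ?sqr_ge0 // ler_norml.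
    have := sqr_ge0 (f x + v.1 x); have := sqr_ge0 (f x - v.1 x).
    have := sqr_ge0 (f x); have := sqr_ge0 (v.1 x).
    rewrite sqrrB sqrrD; move=> *; apply/andP; split; lra.
  - exact: integrableD.
have f2 : \int[mu]_(x in Omega) (f x ^+ 2) = 1.
  have F0 : 0 <= \int[mu]_(x in Omega) (f x ^+ 2) by apply: Rintegral_ge0 => x _; rewrite sqr_ge0.
  by rewrite -[LHS]sqr_sqrtr // -/(L2norm Omega f) f1 expr1n.
have vv : \int[mu]_(x in Omega) (v.1 x * v.1 x) = b_h Th v v by rewrite -b_hf_interior.
have mE : m = m * \int[mu]_(x in Omega) (f x ^+ 2) by rewrite f2 mulr1.
rewrite [X in X + _]mE -vv /b_hf -!RintegralZl //.
rewrite -RintegralD //; last 2 first.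
- exact: (integrableZl mO m if2).
- exact: (integrableZl mO m^-1 iv2).
apply: le_Rintegral => //.
- exact: (integrableZl mO 2 ifv).
- exact: (integrableD mO (integrableZl mO m if2) (integrableZl mO m^-1 iv2)).
move=> x _; rewrite -subr_ge0.
have -> : m * f x ^+ 2 + m^-1 * (v.1 x * v.1 x) - 2 * (f x * v.1 x) =
   m * (f x - m^-1 * v.1 x) ^+ 2 by field; rewrite gt_eqF.
by rewrite mulr_ge0 ?sqr_ge0 // ltW.
Qed.

End interior_integrals.

(** * The approximation property measured by [eta_a] *)

Section approximation.
Variables (R : realType) (d : nat).
Variables (Omega : set 'rV[R]_d) (Omega_poly : convex_polyhedral_domain Omega).
Variables (Th : {fset {fset 'rV[R]_d}}) (Th_mesh : is_mesh Omega Th).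
Variables (r t : nat).
Let Vh := WGspace Omega Th r t.
Variable ah : wfun R d -> wfun R d -> R.
Let bh := b_h Th.
Hypotheses (ba : bilinear_on Vh ah) (bb : bilinear_on Vh bh).
Variables (N : nat) (lamb : nat -> \bar R) (ub : nat -> wfun R d).
Hypothesis eigV : all_eigenpairs ah bh Vh N lamb ub.
Variable S : ('rV[R]_d -> R) -> wfun R d.
Hypothesis S_ok : is_solution_operator Omega ah Vh S.
Variables (W : set (wfun R d)) (WV : W `<=` Vh) (sW : subspace W).

Let sV : subspace Vh. Proof. exact: eig_subspace eigV. Qed.
Let VV : Vh `<=` Vh := fun _ => id.
Let eta := eta_a Omega ah S W.
Let dist f : set R := [set form_norm ah (S f - w) | w in W].
Let unit_dists : set R :=
  [set inf (dist f) | f in [set f | L2fun Omega f /\ L2norm Omega f = 1]].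

Let lbound_dist f : lbound (dist f) 0.
Proof. by move=> _ [w _ <-]; exact: form_norm_ge0. Qed.

Let dist_neq0 f : dist f !=set0.
Proof. by exists (form_norm ah (S f - 0)); exists 0 => //; exact: sW.1. Qed.

Let inf_dist_ge0 f : 0 <= inf (dist f).
Proof. by apply: lb_le_inf; [exact: dist_neq0|exact: lbound_dist]. Qed.

(* The sup defining eta is taken over a bounded set: |S f|_a^2 <= m |f|^2, m
   bounding b(v, v) / a(v, v). *)
Let ubound_unit_dists : has_ubound unit_dists.
Proof.
(* The sum dominates each [rcp (lamb j)], and the summand 1 makes [m] positive. *)
pose m : R := 1 + \sum_(j <- index_iota 1 N.+1) rcp (lamb j).
have rcp0 j : j \in index_iota 1 N.+1 -> 0 <= rcp (lamb j) by exact: (rcp_ge0 eigV).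
have m0 : 0 < m.
  by rewrite ltr_pwDl // big_seq sumr_ge0.
exists (Num.sqrt m) => _ [f [L2f f1] <-].
have [VSf aSf] := S_ok L2f.
have bm : bh (S f) (S f) <= m * ah (S f) (S f).
  apply: (eig_b_le sV ba bb VV eigV VSf (ltW m0)) => j sj _.
  rewrite /m (bigD1_seq j) ?iota_uniq //= addrCA lerDl addr_ge0 //.
  by rewrite big_seq_cond sumr_ge0 // => i /andP[si _]; exact: rcp0.
(* The zero function competes in the infimum, so bounding [S f] itself is enough. *)
apply: (@le_trans _ _ (form_norm ah (S f - 0))).
  by apply: ge_inf; [exists 0; exact: lbound_dist|exists 0 => //; exact: sW.1].
rewrite subr0 ler_wsqrtr //.
(* With [x = ah (S f) (S f)] Young's inequality reads [2 * x <= m + m^-1 * bh (S f) (S f) <= m +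
   x]. *)
have := b_hf_young Omega_poly Th_mesh m0 VSf L2f f1; rewrite -aSf //.
have : m^-1 * bh (S f) (S f) <= ah (S f) (S f) by rewrite ler_pdivrMl.
rewrite /bh; lra.
Qed.

(** If no datum has norm 1, the supremum is taken over the empty set and equals 0. *)
Lemma eta_a_ge0 : 0 <= eta.
Proof.
rewrite /eta /eta_a -/unit_dists; have [U0|/set0P/negP/negPn/eqP ->] := pselect (unit_dists !=set0).
  case: (U0) => x Ux; apply: (@le_trans _ _ x).
    by case: Ux => f _ <-; exact: inf_dist_ge0.
  exact: ub_le_sup.
by rewrite sup0.
Qed.

(** After division by its norm, [g.1] is admissible in the supremum. If [form_norm bh g = 0], then
    [bh g] vanishes on [Vh] by Cauchy-Schwarz and [z = 0] serves. *)
Lemma eta_a_approximation g : Vh g -> exists z, [/\ Vh z,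
  (forall w, Vh w -> ah z w = bh g w) &
  (forall eps, 0 < eps -> exists2 w, W w &
     form_norm ah (z - w) <= eta * form_norm bh g + eps)].
Proof.
move=> Vg; have b_ge0 := eig_b_ge0 sV ba bb VV eigV.
have symb := eig_symb sV ba bb VV eigV.
set n := form_norm bh g; have n_ge0 : 0 <= n by exact: form_norm_ge0.
have [n0|n_neq0] := eqVneq n 0.
  have bg0 : bh g g = 0 by rewrite -(form_norm_sqr b_ge0 Vg) -/n n0 expr0n.
  exists 0; split.
  - exact: sV.1.
  - move=> w Vw; rewrite (form0l sV ba Vw); apply/esym/eqP.
    rewrite -sqrf_eq0 eq_le sqr_ge0 andbT.
    by have := form_CS sV bb symb b_ge0 Vg Vw; rewrite bg0 mul0r.
  - move=> eps eps0; exists 0; first exact: sW.1.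
    rewrite subrr /form_norm (form0l sV ba sV.1) sqrtr0.
    by rewrite addr_ge0 ?mulr_ge0 ?eta_a_ge0 // ltW.
have n_gt0 : 0 < n by rewrite lt_neqAle eq_sym n_neq0.
pose f x := n^-1 * g.1 x.
have L2f : L2fun Omega f by exact: (L2fun_interior Omega_poly Th_mesh n^-1 Vg).
have f1 : L2norm Omega f = 1.
  rewrite (L2norm_interior Omega_poly Th_mesh Vg) ?invr_ge0 //.
  by rewrite -[form_norm _ _]/n mulVf.
have [VSf aSf] := S_ok L2f.
exists (n *: S f); split; first exact: (subspaceZ sV).
  move=> w Vw; rewrite (formZl sV ba _ VSf Vw) aSf //.
  by rewrite (b_hf_scale Omega_poly Th_mesh _ Vg Vw) mulrA mulfV // mul1r.
move=> eps eps0.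
have [_ [w Ww <-] wlt] := inf_adherent (divr_gt0 eps0 n_gt0)
  (conj (dist_neq0 f) (ex_intro _ 0 (@lbound_dist f))).
exists (n *: w); first exact: (subspaceZ sW).
have Vd := subspaceB sV VSf (WV Ww).
rewrite -scalerBr /form_norm (formZl sV ba _ Vd (subspaceZ sV _ Vd)) (formZr sV ba _ Vd Vd).
rewrite mulrA -expr2 sqrtrM ?sqr_ge0 // sqrtr_sqr gtr0_norm // -/(form_norm ah _).
apply: (@le_trans _ _ (n * (eta + eps / n))).
  rewrite ler_wpM2l //; apply: (le_trans (ltW wlt)); rewrite lerD2r.
  by apply: ub_le_sup => //; exists f.
by rewrite mulrDr mulrCA mulfV // mulr1 mulrC.
Qed.

End approximation.

(** * The contraction estimate for the weak Galerkin method *)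

Lemma P1space_to_wfun_subspace (R : realType) d (Omega : set 'rV[R]_d)
  (Th TH : {fset {fset 'rV[R]_d}}) :
  subspace (P1space Omega TH) ->
  subspace [set to_wfun Th w | w in P1space Omega TH].
Proof.
move=> sP; split.
  exists 0; first exact: sP.1.
  transitivity ((fun=> 0, fun=> 0) : wfun R d) => //.
  by congr pair; apply/funext => x; case: ifP.
move=> c _ _ [w Pw <-] [w' Pw' <-]; exists (c *: w + w'); first exact: sP.2.
transitivity ((fun x => c * (to_wfun Th w).1 x + (to_wfun Th w').1 x,
               fun x => c * (to_wfun Th w).2 x + (to_wfun Th w').2 x) : wfun R d) => //.
by congr pair; apply/funext => x /=; case: ifP => _ //; rewrite mulr0 addr0.
Qed.

Theorem theorem3p1 (R : realType) (d : nat) (d23 : d = 2%N \/ d = 3%N)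
  (Omega : set 'rV[R]_d) (Omega_poly : convex_polyhedral_domain Omega)
  (A : 'rV[R]_d -> 'M[R]_d) (c C : R) (c_gt0 : 0 < c) (C_gt0 : 0 < C)
  (A_ok : diffusion_tensor Omega A c C)
  (Th : {fset {fset 'rV[R]_d}}) (h sigma tau : R)
  (Th_mesh : is_mesh Omega Th) (Th_size : mesh_size Th = h)
  (Th_regular : shape_regular sigma Th) (Th_uniform : quasi_uniform tau Th)
  (r t : nat) (t_r : t = r \/ t = r.+1)
  (grad : wfun R d -> {fset 'rV[R]_d} -> pfield R d)
  (grad_ok : is_weak_gradient Th r t (WGspace Omega Th r t) grad) :
  let Vh := WGspace Omega Th r t in
  let ah := a_h Th A grad in
  let bh := b_h Th in
  forall
  (Nh : nat) (lamb : nat -> \bar R) (ub : nat -> wfun R d)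
  (ub_ok : all_eigenpairs ah bh Vh Nh lamb ub)
  (TH : {fset {fset 'rV[R]_d}}) (H : R)
  (TH_mesh : is_mesh Omega TH) (TH_size : mesh_size TH = H)
  (Th_TH : nested Th TH)
  (NH : nat) (NH_dim : has_dim (P1space Omega TH) NH),
  let WH := [set to_wfun Th w | w in P1space Omega TH] in
  forall
  (WH_Vh : WH `<=` Vh)
  (S : ('rV[R]_d -> R) -> wfun R d)
  (S_ok : is_solution_operator Omega ah Vh S)
  (k : nat) (k_ge1 : (1 <= k)%N)
  (uhat : nat -> nat -> wfun R d) (lam : nat -> nat -> \bar R)
  (u : nat -> nat -> wfun R d)
  (method : augmented_subspace_method ah bh Vh WH NH k uhat lam u)
  (F : nat -> wfun R d -> wfun R d)
  (F_ok : forall m, (1 <= m)%N -> is_spectral_projection ah Vh k (u m) (F m)),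
  let delta m i := spectral_gap k (NH + k) (lam m) (lamb i) in
  forall
  (delta_gt0 : forall m i, (1 <= m)%N -> (1 <= i <= k)%N -> 0 < delta m i)
  (l i : nat) (l_ge1 : (1 <= l)%N) (i_k : (1 <= i <= k)%N),
  let eta := eta_a Omega ah S WH in
  let gamma :=
    fine (lamb i)
    * Num.sqrt (1 + eta ^+ 2 * rcp (lamb k.+1) / delta l.+1 i ^+ 2)
    * (1 + rcp (lamb k.+1) / delta l i)
    * eta ^+ 2 in
  form_norm ah (ub i - F l.+1 (ub i)) <= gamma * form_norm ah (ub i - F l (ub i)).
Proof.
move=> Vh ah bh Nh lamb ub ub_ok TH H TH_mesh TH_size Th_TH NH NH_dim WH WH_Vh S S_ok
  k k_ge1 uhat lam u method F F_ok delta delta_gt0 l i l_ge1 i_k.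
have sV : subspace Vh := eig_subspace ub_ok.
have d_gt0 : (0 < d)%N by case: d23 => ->.
have ba : bilinear_on Vh ah := a_h_bilinear d_gt0 Omega_poly A_ok Th_mesh sV grad_ok.
have bb : bilinear_on Vh bh by exact: (b_h_bilinear Th_mesh).
have sW : subspace WH := P1space_to_wfun_subspace Th (has_dim_subspace NH_dim).
have eta_ge0 := eta_a_ge0 Omega_poly Th_mesh ba bb ub_ok S_ok sW.
have etaP := eta_a_approximation Omega_poly Th_mesh ba bb ub_ok S_ok WH_Vh sW.
have dm m : (1 <= m)%N -> 0 < delta m i by move=> m1; exact: delta_gt0.
exact: (augmented_subspace_contraction ba bb ub_ok WH_Vh sW.1 eta_ge0 etaP
  method F_ok l_ge1 i_k dm).
Qed.
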